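(* Consider the $p$-tensor Curie-Weiss model for $p\ge3$. (1) For every $\beta>\beta_0\ge\log2$ and $\delta\in(0,1)$, $$c_{\hat{\beta}_{\mathrm{MPL}}}(\beta_0,\beta,p) = c_{\hat{\beta}_{\mathrm{ML}}}(\beta_0,\beta,p)\quad\text{and}\quad N_{\hat{\beta}_{\mathrm{MPL}}}^*(\beta_0,\beta,\delta,p) = N_{\hat{\beta}_{\mathrm{ML}}}^*(\beta_0,\beta,\delta,p).$$ Consequently, $\mathrm{eff}(\hat{\beta}_{\mathrm{ML}},\hat{\beta}_{\mathrm{MPL}};\beta_0,\beta)=1$ in this regime. (2) For every $\beta_0\in(\beta^*(p),\log2)$ and $\delta\in(0,1)$, for all sufficiently large $\beta>\beta_0$ one has $c_{\hat{\beta}_{\mathrm{MPL}}}(\beta_0,\beta,p)\ne c_{\hat{\beta}_{\mathrm{ML}}}(\beta_0,\beta,p)$, $N_{\hat{\beta}_{\mathrm{MPL}}}^*(\beta_0,\beta,\delta,p)\ne N_{\hat{\beta}_{\mathrm{ML}}}^*(\beta_0,\beta,\delta,p)$, and $\mathrm{eff}(\hat{\beta}_{\mathrm{ML}},\hat{\beta}_{\mathrm{MPL}};\beta_0,\beta)>1$.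
   Context: **Model.** For an integer $p\ge2$ and $n\ge 1$, the $p$-tensor Curie-Weiss model with parameter $\beta$ is the probability mass function on $\{-1,1\}^n$ $$\mathbb{P}_{\beta,p}(x)=\frac{\exp\{\beta n^{1-p}\sum_{1\le i_1,\dots,i_p\le n}x_{i_1}\cdots x_{i_p}\}}{2^nZ_n(\beta,p)},$$ with $Z_n(\beta,p)$ the normalizing constant. $X=(X_1,\dots,X_n)$ denotes a sample from it and $\overline{X}_n=\frac1n\sum_{i=1}^nX_i$. **Threshold.** For $x\in[-1,1]$ (with $0\log0=0$), $H_{\beta,p}(x)=\beta x^p-\tfrac12\{(1+x)\log(1+x)+(1-x)\log(1-x)\}$, and $\beta^*(p)=\sup\{\beta\ge0:\sup_{x\in[-1,1]}H_{\beta,p}(x)=0\}$ (which satisfies $\beta^*(p)<\log2$). **Estimators.** $\hat{\beta}_{\mathrm{ML}}$ is the maximum likelihood estimator of $\beta$, i.e. the maximizer of $\beta\mapsto\mathbb{P}_{\beta,p}(X)$ (equal to $\pm\infty$ if the supremum is only approached at $\pm\infty$). The maximum pseudolikelihood estimator is given explicitly by $\hat{\beta}_{\mathrm{MPL}}=p^{-1}\overline{X}_n^{1-p}\tanh^{-1}(\overline{X}_n)$ if $\overline{X}_n\ne0$ and $0$ if $\overline{X}_n=0$ (extended-real valued when $\overline X_n=\pm1$). **Bahadur slope.** Consider testing $H_0:\beta=\beta_0$ versus $H_1:\beta>\beta_0$ with $\beta_0>\beta^*(p)$ using $T_n=\sqrt n(\hat\beta-\beta_0)$, where $\hat\beta$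 is $\hat{\beta}_{\mathrm{ML}}$ or $\hat{\beta}_{\mathrm{MPL}}$, large values being significant. Let $F_{T_n,\beta_0}$ be the cumulative distribution function of $T_n$ under $\mathbb{P}_{\beta_0,p}$ and $L_n=1-F_{T_n,\beta_0}(T_n)$. The (weak) Bahadur slope of $\hat\beta$ at the alternative $\beta$ is the constant $c_{\hat\beta}(\beta_0,\beta,p)$ such that $\frac1n\log L_n\to-\frac12c_{\hat\beta}(\beta_0,\beta,p)$ in probability as $n\to\infty$ when $X\sim\mathbb{P}_{\beta,p}$. The asymptotic optimal sample size is $N^*_{\hat\beta}(\beta_0,\beta,\delta,p)=-2\log(\delta)/c_{\hat\beta}(\beta_0,\beta,p)$, and $\mathrm{eff}(\hat\beta_1,\hat\beta_2;\beta_0,\beta)=c_{\hat\beta_1}(\beta_0,\beta,p)/c_{\hat\beta_2}(\beta_0,\beta,p)$. *)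

(* Defs.v *)
From HB Require Import structures.
From mathcomp Require Import all_boot all_order all_algebra.
From mathcomp Require Import all_classical all_reals all_analysis.

Set Implicit Arguments.
Unset Strict Implicit.
Unset Printing Implicit Defensive.

Import Order.TTheory GRing.Theory Num.Theory.
Import numFieldNormedType.Exports.

Local Open Scope classical_set_scope.
Local Open Scope ring_scope.

(* A point of {-1,1}^n, with [true] encoding the spin +1 and [false] the
   spin -1. *)
Definition config (n : nat) := {ffun 'I_n -> bool}.

Section CurieWeiss.
Context {R : realType}.

Definition spin n (x : config n) (i : 'I_n) : R := if x i then 1 else -1.

Definition xbar n (x : config n) : R := n%:R^-1 * \sum_(i < n) spin x i.

(* The multi-indices (i_1, ..., i_p) are the functions from 'I_p to 'I_n. *)
Definition tensor_sum (p : nat) n (x : config n) : R :=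
  \sum_(i : {ffun 'I_p -> 'I_n}) \prod_(k < p) spin x (i k).

Definition cw_weight (p : nat) (b : R) n (x : config n) : R :=
  expR (b * n%:R ^ (1 - p%:Z) * tensor_sum p x).

Definition cw_Z (p : nat) (b : R) (n : nat) : R :=
  (2 ^+ n)^-1 * \sum_(x : config n) cw_weight p b x.

Definition cw_pmf (p : nat) (b : R) n (x : config n) : R :=
  cw_weight p b x / (2 ^+ n * cw_Z p b n).

Definition cw_Pr (p : nat) (b : R) n (A : pred (config n)) : R :=
  \sum_(x : config n | A x) cw_pmf p b x.

(* Since [ln 0 = 0], the convention 0 log 0 = 0 holds at x = 1 and x = -1. *)
Definition cw_H (p : nat) (b x : R) : R :=
  b * x ^+ p - 2^-1 * ((1 + x) * ln (1 + x) + (1 - x) * ln (1 - x)).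

Definition beta_star (p : nat) : R :=
  sup [set b | 0 <= b /\ sup [set cw_H p b x | x in `[-1, 1]] = 0].

Definition estimator := forall n : nat, config n -> \bar R.

Definition is_mle (p : nat) n (x : config n) (b : \bar R) : Prop :=
  let L := fun c : R => cw_pmf p c x in
  match b with
  | EFin r => forall c, L c <= L r
  | +oo%E => (forall c, L c < sup (range L)) /\ L c @[c --> +oo] --> sup (range L)
  | -oo%E => (forall c, L c < sup (range L)) /\ L c @[c --> -oo] --> sup (range L)
  end.

(* The maximizer is unique unless the likelihood is constant, which for n >= 1
   and p >= 1 only happens when n = 1 and p is even; [xget] then picks an
   arbitrary maximizer. *)
Definition mle (p : nat) : estimator :=
  fun n x => xget 0%E [set b | is_mle p x b].

(* Inverse hyperbolic tangent on [-1, 1], infinite at the endpoints. *)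
Definition eartanh (x : R) : \bar R :=
  if x == 1 then +oo%E
  else if x == -1 then -oo%E
  else (2^-1 * ln ((1 + x) / (1 - x)))%:E.

(* The maximum pseudolikelihood estimator of the model, given by its explicit
   formula. *)
Definition mple (p : nat) : estimator := fun n x =>
  if xbar x == 0 then 0%E
  else ((p%:R^-1 * xbar x ^ (1 - p%:Z))%:E * eartanh (xbar x))%E.

Definition test_stat (bhat : estimator) (b0 : R) n (x : config n) : \bar R :=
  ((Num.sqrt n%:R)%:E * (bhat n x - b0%:E))%E.

Definition test_cdf (p : nat) (bhat : estimator) (b0 : R) (n : nat)
    (t : \bar R) : R :=
  cw_Pr p b0 (fun y : config n => (test_stat bhat b0 y <= t)%E).

Definition attained_level (p : nat) (bhat : estimator) (b0 : R) n
    (x : config n) : R :=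
  1 - test_cdf p bhat b0 n (test_stat bhat b0 x).

(* Convergence in probability of (1/n) log L_n to -c/2 under the parameter b.
   The logarithm is extended-real valued because L_n vanishes when T_n takes
   its largest possible value. *)
Definition is_bahadur_slope (p : nat) (bhat : estimator) (b0 b c : R) : Prop :=
  forall e : R, 0 < e ->
    cw_Pr p b (fun x : config n =>
      (e%:E < `| (n%:R^-1)%:E * lne (attained_level p bhat b0 x)%:E
                 - (- (2^-1 * c))%:E |)%E) @[n --> \oo] --> (0 : R).

Definition has_bahadur_slope (p : nat) (bhat : estimator) (b0 b : R) : Prop :=
  exists c, is_bahadur_slope p bhat b0 b c.

(* Meaningful only under [has_bahadur_slope p bhat b0 b]; c is then unique. *)
Definition bahadur_slope (p : nat) (bhat : estimator) (b0 b : R) : R :=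
  xget 0 [set c | is_bahadur_slope p bhat b0 b c].

Definition opt_sample_size (p : nat) (bhat : estimator) (b0 b d : R) : R :=
  - 2 * ln d / bahadur_slope p bhat b0 b.

Definition eff (p : nat) (bhat1 bhat2 : estimator) (b0 b : R) : R :=
  bahadur_slope p bhat1 b0 b / bahadur_slope p bhat2 b0 b.

End CurieWeiss.

Arguments estimator R : clear implicits.

(* Main.v *)
(* By the method of types, the probability that the sample mean equals [m] is
   [exp (n (H m - sup H))] up to a polynomial factor.  Above the threshold, [H_b]
   has a positive maximum at the larger root [r b] of [g x = b], where
   [g x = artanh x / (p x^(p-1))] decreases and then increases on ]0, 1[ (this is
   where p >= 3 is used), and the sample mean concentrates at [r b], up to sign
   for even p.
   The maximum likelihood estimator is strictly increasing in [(sample mean)^p],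
   so its level is the probability of a mean beyond [r b] and its slope is
   [2 (H_b0 (r b0) - H_b0 (r b))].  The pseudolikelihood estimator is [g] of the
   sample mean, which also exceeds [b] near 0, where [H_b0] is close to 0: its
   slope is [2 (H_b0 (r b0) - max 0 (H_b0 (r b)))].  Since [H_b0] decreases from
   [r b0] to [H_b0 1 = b0 - ln 2], and [r b -> 1] as [b -> oo], the two slopes
   agree for [b0 >= ln 2] and differ for [b0 < ln 2] and large [b]. *)

Require Import Defs.
From HB Require Import structures.
From mathcomp Require Import all_boot all_order all_algebra.
From mathcomp Require Import all_classical all_reals all_analysis.
From mathcomp Require Import ring lra.

Set Implicit Arguments.
Unset Strict Implicit.
Unset Printing Implicit Defensive.

Import Order.TTheory GRing.Theory Num.Theory.
Import numFieldNormedType.Exports.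

Local Open Scope classical_set_scope.
Local Open Scope ring_scope.

(** * Binomial coefficients and the sizes of type classes *)

(** The Poisson weights [k^j / j!] of mean [k] peak at [j = k]: between [k!] and [j!] lie [|j - k|]
    factors, all above [k] when [k < j] and all at most [k] when [j < k]. *)
Lemma fact_mul_expn k j : (k`! * k ^ j <= j`! * k ^ k)%N.
Proof.
have up m i : (m`! * m ^ i <= (m + i)`!)%N.
  elim: i => [|i IH]; first by rewrite expn0 muln1 addn0.
  by rewrite addnS factS expnS mulnCA leq_mul // (leq_trans (leq_addr i m)).
have down m i : ((m + i)`! <= m`! * (m + i) ^ i)%N.
  elim: i m => [|i IH] m; first by rewrite addn0 expn0 muln1.
  rewrite -addSnnS (leq_trans (IH _)) // factS expnS addSnnS mulnCA mulnA.
  by rewrite leq_mul // leq_mul // addnS ltnS leq_addr.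
have [le_kj|/ltnW le_jk] := leqP k j.
  by rewrite -(subnKC le_kj) expnD mulnCA [X in (_ <= X)%N]mulnC leq_mul // up.
set i := (k - j)%N; have -> : k = (j + i)%N by rewrite subnKC.
by rewrite [X in (_ <= _ * X)%N]expnD mulnCA mulnC leq_mul // mulnC down.
Qed.

(** A single term of the binomial expansion of [(k + (n - k))^n]. *)
Lemma bin_type_le n k : (k <= n)%N ->
  ('C(n, k) * (k ^ k * (n - k) ^ (n - k)) <= n ^ n)%N.
Proof.
move=> le_kn; rewrite -{4}(subnK le_kn) expnDn.
rewrite (bigD1 (inord k : 'I_n.+1)) //= inordK ?ltnS // [(k ^ k * _)%N]mulnC.
by rewrite leq_addr.
Qed.

(* [k] is a mode of the binomial law with parameters [n] and [k / n]. *)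
Lemma bin_type_ge n k : (k <= n)%N ->
  (n ^ n <= n.+1 * ('C(n, k) * (k ^ k * (n - k) ^ (n - k))))%N.
Proof.
move=> le_kn; rewrite -{1}(subnK le_kn) expnDn.
rewrite -[X in (_ <= X * _)%N]card_ord -sum_nat_const; apply: leq_sum => j _.
have le_jn : (j <= n)%N by rewrite -ltnS.
rewrite -(@leq_pmul2l (k`! * (n - k)`! * (j`! * (n - j)`!))%N); last first.
  by rewrite !muln_gt0 !fact_gt0.
(* Comparing Poisson weights in each of the two factors bounds the [j]-th term of the expansion by
   the [k]-th. *)
have := leq_mul (fact_mul_expn k j) (fact_mul_expn (n - k) (n - j)).
have := bin_fact le_kn; have := bin_fact le_jn.
set a := 'C(n, j); set b := 'C(n, k) => Ha Hb.
move/(leq_mul (leqnn n`!)); rewrite -{1}Ha -Hb.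
by congr (_ <= _)%N; ring.
Qed.

Definition ups n (x : config n) : nat := #|[set i | x i]%SET|.

Lemma ups_le n (x : config n) : (ups x <= n)%N.
Proof. by rewrite -[X in (_ <= X)%N]card_ord max_card. Qed.

Lemma card_ups n k : #|[set y : config n | ups y == k]%SET| = 'C(n, k).
Proof.
rewrite -[X in 'C(X, _)]card_ord -card_draws.
rewrite -(@card_imset _ _ (fun y : config n => [set i | y i]%SET)); last first.
  by move=> y z /setP e; apply/ffunP => i; have := e i; rewrite !inE.
apply: eq_card => A; apply/imsetP/idP => [[y]|].
  by rewrite !inE => yk ->.
rewrite inE => Ak; exists [ffun i => i \in A] => //.
  by rewrite inE /ups; apply/eqP; rewrite -(eqP Ak); apply: eq_card => i; rewrite inE ffunE.
by apply/setP => i; rewrite inE ffunE.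
Qed.

(** * The law of the sample mean *)

Section SampleMean.
Context {R : realType}.
Implicit Types (b h f e : R).

Lemma ler_sum_sub (I : finType) (P Q : pred I) (F : I -> R) :
  (forall i, 0 <= F i) -> (forall i, P i -> Q i) ->
  \sum_(i | P i) F i <= \sum_(i | Q i) F i.
Proof.
move=> F0 PQ; rewrite big_mkcond [leRHS]big_mkcond /=.
apply: ler_sum => i _; case: ifPn => [/PQ -> //|_]; by case: ifP.
Qed.

Lemma xbarE n (x : config n) : (0 < n)%N ->
  xbar x = 2 * (ups x)%:R / n%:R - 1 :> R.
Proof.
move=> n0; have nn0 : n%:R != 0 :> R by rewrite pnatr_eq0 -lt0n.
have -> : xbar x = n%:R^-1 * \sum_(i < n) (2 * (x i)%:R - 1) :> R.
  congr (_ * _); apply: eq_bigr => i _; rewrite /spin.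
  by case: (x i); rewrite ?mulr1 ?mulr0 ?sub0r //; lra.
rewrite sumrB -mulr_sumr sumr_const card_ord -natr_sum.
have -> : (\sum_(i < n) x i)%N = ups x.
  by rewrite /ups -sum1dep_card [RHS]big_mkcond; apply: eq_bigr => i _; case: (x i).
by field.
Qed.

Lemma xbar_itv n (x : config n) : (0 < n)%N -> -1 <= (xbar x : R) <= 1.
Proof.
move=> n0; have nn0 : 0 < n%:R :> R by rewrite ltr0n.
rewrite xbarE // -!mulrA.
have : 0 <= (ups x)%:R / n%:R :> R by rewrite divr_ge0.
have : (ups x)%:R / n%:R <= 1 :> R.
  by rewrite ler_pdivrMr // mul1r ler_nat ups_le.
lra.
Qed.

(** The sum over all multi-indices factors as the [p]-th power of the sum of the spins, so the
    weight depends on the sample mean only. *)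
Lemma cw_weightE p b n (x : config n) : (0 < n)%N ->
  cw_weight p b x = expR (n%:R * (b * xbar x ^+ p)).
Proof.
move=> n0; have nn0 : n%:R != 0 :> R by rewrite pnatr_eq0 -lt0n.
rewrite /cw_weight; congr expR.
have -> : tensor_sum p x = (n%:R * xbar x) ^+ p :> R.
  rewrite /xbar mulVKf // -[p in RHS]card_ord -prodr_const bigA_distr_bigA /=.
  by apply: eq_bigr => f _; apply: eq_bigr.
rewrite exprMn expfzDr // expr1z -invr_expz -exprnP.
by have := expf_neq0 p nn0; set N := _ ^+ p => N0; field.
Qed.

(** Identifies the entropy part of [cw_H] with the power product of the binomial bounds; the
    convention [0 ln 0 = 0] matches [0^0 = 1] when [k] is [0] or [n]. *)
Lemma expR_entropy n k : (0 < n)%N -> (k <= n)%N ->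
  let m := 2 * k%:R / n%:R - 1 : R in
  expR (n%:R * (2^-1 * ((1 + m) * ln (1 + m) + (1 - m) * ln (1 - m)))) =
  2 ^+ n * (k ^ k * (n - k) ^ (n - k))%:R / (n ^ n)%:R.
Proof.
move=> n0 kn m; have nn0 : n%:R != 0 :> R by rewrite pnatr_eq0 -lt0n.
have E (j : nat) : expR (j%:R * ln (2 * j%:R / n%:R)) = (2 * j%:R / n%:R) ^+ j :> R.
  case: (posnP j) => [->|j0]; first by rewrite mul0r expR0 expr0.
  by rewrite expRM_natl lnK // posrE divr_gt0 ?mulr_gt0 ?ltr0n.
have e1 : 1 + m = 2 * k%:R / n%:R by rewrite /m; ring.
have e2 : 1 - m = 2 * (n - k)%:R / n%:R by rewrite /m natrB //; field.
rewrite e1 e2; set l1 := ln _; set l2 := ln _.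
have -> : n%:R * (2^-1 * (2 * k%:R / n%:R * l1 + 2 * (n - k)%:R / n%:R * l2)) =
  k%:R * l1 + (n - k)%:R * l2 by field.
have split_n (x : R) : x ^+ n = x ^+ k * x ^+ (n - k) by rewrite -exprD subnKC.
rewrite expRD !E !exprMn natrM !natrX !split_n !exprVn.
have := expf_neq0 k nn0; have := expf_neq0 (n - k) nn0.
set u := n%:R ^+ k; set v := n%:R ^+ (n - k) => u0 v0.
set x1 := 2 ^+ k; set x2 := 2 ^+ (n - k); set x3 := _ ^+ k; set x4 := _ ^+ (n - k).
by field; rewrite u0 v0.
Qed.

(** The weight is constant on the type class of [x], which has ['C(n, k)] elements; the two binomial
    bounds then locate its total up to the factor [n + 1]. *)
Lemma type_sum_bounds p b n (x : config n) : (0 < n)%N ->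
  let S := \sum_(y : config n | ups y == ups x) cw_weight p b y in
  let E := 2 ^+ n * expR (n%:R * cw_H p b (xbar x)) in
  E <= n.+1%:R * S /\ S <= E.
Proof.
move=> n0 S E; have nn0 : 0 < n%:R :> R by rewrite ltr0n.
set k := ups x in S *; have kn : (k <= n)%N := ups_le x.
set D : R := (k ^ k * (n - k) ^ (n - k))%:R.
have D0 : 0 < D.
  have P j : (0 < j ^ j)%N by case: j => // j; rewrite expn_gt0.
  by rewrite ltr0n muln_gt0 !P.
have N0 : 0 < (n ^ n)%:R :> R by rewrite ltr0n expn_gt0 n0.
set w := expR (n%:R * (b * xbar x ^+ p)).
have -> : S = 'C(n, k)%:R * w.
  rewrite -card_ups mulr_natl /S -sumr_const; apply: eq_big => y.
    by rewrite inE.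
  rewrite ?inE => /eqP yk; rewrite cw_weightE // /w; congr expR.
  by rewrite !xbarE // yk.
have -> : E = (n ^ n)%:R / D * w.
  rewrite /E /cw_H mulrBr expRD expRN -/w xbarE // expR_entropy // -/k -/D.
  have alg (t d N v : R) : t != 0 -> d != 0 -> N != 0 ->
    t * (v / (t * d / N)) = N / d * v by move=> ? ? ?; field; rewrite ?mulf_neq0 //; apply/and3P.
  by rewrite alg ?expf_neq0 ?gt_eqF.
have w0 : 0 < w by exact: expR_gt0.
rewrite mulrA; split; rewrite ler_pM2r //.
  by rewrite ler_pdivrMr // /D -!natrM ler_nat -mulnA bin_type_ge.
by rewrite ler_pdivlMr // /D -!natrM ler_nat bin_type_le.
Qed.

Lemma cw_weight_gt0 p b n (x : config n) : 0 < cw_weight p b x.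
Proof. exact: expR_gt0. Qed.

Lemma cw_sum_gt0 p b n : 0 < \sum_(x : config n) cw_weight p b x.
Proof.
rewrite (bigD1 [ffun=> true]) //= ltr_pwDl ?cw_weight_gt0 //.
by apply: sumr_ge0 => y _; exact/ltW/cw_weight_gt0.
Qed.

Lemma cw_PrE p b n (A : pred (config n)) :
  cw_Pr p b A = (\sum_(x | A x) cw_weight p b x) / \sum_(x : config n) cw_weight p b x.
Proof.
rewrite /cw_Pr mulr_suml; apply: eq_bigr => x _; rewrite /cw_pmf /cw_Z.
by rewrite mulVKf // expf_neq0.
Qed.

Lemma cw_Pr_le_sub p b n (A B : pred (config n)) :
  (forall x, A x -> B x) -> cw_Pr p b A <= cw_Pr p b B.
Proof.
move=> AB; rewrite !cw_PrE ler_pM2r ?invr_gt0 ?cw_sum_gt0 //.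
by apply: ler_sum_sub => x; [exact/ltW/cw_weight_gt0|exact: AB].
Qed.

Lemma cw_Pr_ge0 p b n (A : pred (config n)) : 0 <= cw_Pr p b A.
Proof.
rewrite cw_PrE divr_ge0 //; last exact/ltW/cw_sum_gt0.
by apply: sumr_ge0 => y _; exact/ltW/cw_weight_gt0.
Qed.

Lemma cw_PrC p b n (A : pred (config n)) : 1 - cw_Pr p b A = cw_Pr p b (predC A).
Proof.
have S0 := cw_sum_gt0 p b n.
rewrite !cw_PrE -[1](@divff _ (\sum_(x : config n) cw_weight p b x)) ?gt_eqF //.
by rewrite [X in X / _ - _](bigID A) /= -mulrBl addrAC subrr add0r.
Qed.

Lemma cw_sum_le p b n (A : pred (config n)) h : (0 < n)%N ->
  (forall y, A y -> cw_H p b (xbar y) <= h) ->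
  \sum_(x | A x) cw_weight p b x <= n.+1%:R * (2 ^+ n * expR (n%:R * h)).
Proof.
move=> n0 Ah; have nn0 : 0 < n%:R :> R by rewrite ltr0n.
rewrite (partition_big (fun y => inord (ups y) : 'I_n.+1) predT) //=.
rewrite -[X in X%:R * _]card_ord mulr_natl -sumr_const; apply: ler_sum => k _.
case: (pselect (exists2 y, A y & ups y = k)) => [[y Ay yk]|no]; last first.
  rewrite big1 ?mulr_ge0 ?expR_ge0 // => y /andP[Ay /eqP yk].
  by exfalso; apply: no; exists y => //; rewrite -yk inordK ?ltnS ?ups_le.
have [_ SE] := type_sum_bounds p b y n0.
apply: le_trans (le_trans SE _); last first.
  by rewrite ler_pM2l ?exprn_gt0 // ler_expR ler_pM2l // Ah.
apply: ler_sum_sub => [z|z /andP[_ /eqP zk]]; first exact/ltW/cw_weight_gt0.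
by rewrite yk -zk inordK ?ltnS ?ups_le.
Qed.

Lemma cw_sum_ge p b n (A : pred (config n)) h (z : config n) : (0 < n)%N ->
  (forall y, ups y = ups z -> A y) -> h <= cw_H p b (xbar z) ->
  2 ^+ n * expR (n%:R * h) <= n.+1%:R * \sum_(x | A x) cw_weight p b x.
Proof.
move=> n0 zA hz; have nn0 : 0 < n%:R :> R by rewrite ltr0n.
have [ES _] := type_sum_bounds p b z n0.
apply: (@le_trans _ _ (2 ^+ n * expR (n%:R * cw_H p b (xbar z)))).
  by rewrite ler_pM2l ?exprn_gt0 // ler_expR ler_pM2l.
apply: le_trans ES _; rewrite ler_pM2l //.
apply: ler_sum_sub => [y|y /eqP/zA //]; exact/ltW/cw_weight_gt0.
Qed.

(** The numerator runs over at most [n + 1] type classes, and the normalizing sum is bounded below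
    by the class of [z] alone; each bound costs a factor [n + 1]. *)
Lemma cw_Pr_le p b n (A : pred (config n)) h f (z : config n) : (0 < n)%N ->
  (forall y, A y -> cw_H p b (xbar y) <= h) -> f <= cw_H p b (xbar z) ->
  cw_Pr p b A <= n.+1%:R ^+ 2 * expR (n%:R * (h - f)).
Proof.
move=> n0 Ah fz; have num := cw_sum_le n0 Ah.
have den := @cw_sum_ge p b n predT f z n0 (fun _ _ => isT) fz.
rewrite cw_PrE ler_pdivrMr ?cw_sum_gt0 //; apply: le_trans num _.
rewrite mulrBr expRD expRN.
move: den; set T := \sum_(x | _) _; set f' := expR _; set h' := expR _ => den.
have [h0 f0] : 0 < h' /\ 0 < f' by split; exact: expR_gt0.
have /ler_wpM2l/(_ _ _ den) : 0 <= n.+1%:R * (h' / f').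
  by rewrite mulr_ge0 ?divr_ge0 ?ltW.
congr (_ <= _); last by ring.
by field; rewrite gt_eqF.
Qed.

(** Dual to the upper bound: the class of [z] alone in the numerator, all classes in the normalizing
    sum. *)
Lemma cw_Pr_ge p b n (A : pred (config n)) h f (z : config n) : (0 < n)%N ->
  (forall y, ups y = ups z -> A y) -> h <= cw_H p b (xbar z) ->
  (forall y : config n, cw_H p b (xbar y) <= f) ->
  expR (n%:R * (h - f)) <= n.+1%:R ^+ 2 * cw_Pr p b A.
Proof.
move=> n0 zA hz Hf; have num := cw_sum_ge n0 zA hz.
have den := @cw_sum_le p b n predT f n0 (fun y _ => Hf y).
rewrite cw_PrE mulrA ler_pdivlMr ?cw_sum_gt0 // mulrBr expRD expRN.
move: num den; set T := \sum_(x | A x) _; set S := \sum_(x | _) _.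
set h' := expR _; set f' := expR _ => num den.
have [h0 f0] : 0 < h' /\ 0 < f' by split; exact: expR_gt0.
have E0 : 0 < 2 ^+ n :> R by rewrite exprn_gt0.
rewrite -(@ler_pM2l _ (2 ^+ n * f')) ?mulr_gt0 //.
have S0 : 0 <= S by exact/ltW/cw_sum_gt0.
have := ler_pM (ltW (mulr_gt0 E0 h0)) S0 num den.
congr (_ <= _); last by ring.
have alg (t u v w : R) : v != 0 -> t * u * w = t * v * (u / v * w).
  by move=> v0; field.
by apply: alg; rewrite gt_eqF.
Qed.
End SampleMean.

(** * The shape of the rate function *)

Section Artanh.
Context {R : realType}.
Implicit Types (b h f e x y : R).

(** The derivative is asked for only inside the interval because [cw_H] is followed up to the
    endpoint 1, where it has none. *)
Lemma gt0_derive_lt (f df : R -> R) (a c : R) : a < c ->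
  (forall x, a < x < c -> is_derive x 1 f (df x)) ->
  {within `[a, c], continuous f} ->
  (forall x, a < x < c -> 0 < df x) -> f a < f c.
Proof.
move=> ac fdf fc df0.
have fdf' x : x \in `]a, c[%R -> is_derive x 1 f (df x) by rewrite in_itv; exact: fdf.
have [x] := MVT ac fdf' fc.
by rewrite in_itv => /df0 x0 e; rewrite -subr_gt0 e mulr_gt0 // subr_gt0.
Qed.

Lemma is_derive_within_continuous (f df : R -> R) (a c : R) :
  (forall x, a <= x <= c -> is_derive x 1 f (df x)) ->
  {within `[a, c], continuous f}.
Proof.
move=> fdf; apply: derivable_within_continuous => x.
by rewrite in_itv => /fdf [].
Qed.

Definition artanh x : R := 2^-1 * (ln (1 + x) - ln (1 - x)).

Lemma artanh0 : artanh 0 = 0.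
Proof. by rewrite /artanh addr0 subr0 subrr mulr0. Qed.

Lemma artanhN x : artanh (- x) = - artanh x.
Proof. by rewrite /artanh opprK -mulrN opprB. Qed.

Lemma eartanhE x : -1 < x < 1 -> eartanh x = (artanh x)%:E.
Proof.
move=> /andP[x1 x2]; rewrite /eartanh lt_eqF // gt_eqF //.
by rewrite ln_div // posrE; lra.
Qed.

Lemma is_derive_ln1D x : -1 < x ->
  is_derive x 1 (fun t : R => ln (1 + t)) (1 + x)^-1.
Proof.
move=> x1; have dl : is_derive (1 + x) 1 (@ln R) (1 + x)^-1.
  by apply: is_derive1_ln; lra.
have dd : is_derive x 1 (fun t : R => 1 + t) 1.
  by have := is_deriveD (is_derive_cst (1 : R) x 1) (is_derive_id x 1); rewrite add0r.
by have := is_derive1_comp (f := @ln R) dl dd; rewrite mulr1.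
Qed.

Lemma is_derive_ln1B x : x < 1 ->
  is_derive x 1 (fun t : R => ln (1 - t)) (- (1 - x)^-1).
Proof.
move=> x1; have dl : is_derive (1 - x) 1 (@ln R) (1 - x)^-1.
  by apply: is_derive1_ln; lra.
have dd : is_derive x 1 (fun t : R => 1 - t) (-1).
  by have := is_deriveB (is_derive_cst (1 : R) x 1) (is_derive_id x 1); rewrite sub0r.
by have := is_derive1_comp (f := @ln R) (g := fun t => 1 - t) dl dd; rewrite mulrN1.
Qed.

Lemma is_derive_artanh x : -1 < x < 1 -> is_derive x 1 artanh (1 - x ^+ 2)^-1.
Proof.
move=> /andP[x1 x2].
have := is_deriveZ 2^-1 (is_deriveB (is_derive_ln1D x1) (is_derive_ln1B x2)).
move/is_derive_eq; apply; rewrite /GRing.scale /=; field.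
by apply/and3P; split; [|rewrite gt_eqF // | rewrite gt_eqF //]; nra.
Qed.

(** Apply [ln u < u] at [u = 1 / sqrt x]. This gives the continuity of [x ln x] at 0. *)
Lemma xlnx_bound x : x <= 1 -> `|x * ln x| <= 2 * Num.sqrt x.
Proof.
have [x0 _|x0 x1] := leP x 0; first by rewrite ln0 // mulr0 normr0 mulr_ge0 ?sqrtr_ge0.
have s0 : 0 < Num.sqrt x by rewrite sqrtr_gt0.
have := @ln_sublinear R (Num.sqrt x)^-1.
rewrite invr_gt0 lnV // => /(_ s0).
rewrite ler0_norm; last by rewrite mulr_ge0_le0 ?ln_le0 // ltW.
have -> : ln x = 2 * ln (Num.sqrt x).
  by rewrite -[in LHS](sqr_sqrtr (ltW x0)) lnXn // mulr_natl.
rewrite mulrA; have <- : Num.sqrt x ^+ 2 * 2 = x * 2 by rewrite sqr_sqrtr // ltW.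
move: (Num.sqrt x) s0 => s s0 l1.
have := ler_wpM2l (ltW (exprn_gt0 2 s0)) (ltW l1).
rewrite expr2 mulfK ?gt_eqF //; lra.
Qed.

Lemma continuous_xlnx : continuous (fun x => x * ln x).
Proof.
move=> x; have [x0|x0] := ltP 0 x.
  by apply: cvgM; [exact: cvg_id|exact: continuous_ln].
rewrite /continuous_at [in X in _ --> X]ln0 // mulr0.
have sx : 2 * Num.sqrt t @[t --> x] --> (0 : R).
  rewrite -(mulr0 2) -(ler0_sqrtr x0); apply: cvgM; first exact: cvg_cst.
  exact: sqrt_continuous.
apply/norm_cvg0P; apply: (squeeze_cvgr _ (cvg_cst (0 : R)) sx).
near=> t; rewrite normr_ge0 xlnx_bound //.
apply/ltW; near: t; apply: (cvgr_lt x) => //; exact: le_lt_trans x0 ltr01.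
Unshelve. all: by end_near. Qed.

Lemma continuous_cw_H p b : continuous (cw_H p b).
Proof.
have cl (s : R) : continuous (fun x => (1 + s * x) * ln (1 + s * x)).
  move=> x; apply: (@continuous_comp _ _ _ (fun x => 1 + s * x) (fun u => u * ln u)).
    by apply: cvgD; [exact: cvg_cst|apply: cvgM; [exact: cvg_cst|exact: cvg_id]].
  exact: continuous_xlnx.
move=> x; apply: cvgB; first by apply: cvgM; [exact: cvg_cst|exact: exprn_continuous].
apply: cvgM; first exact: cvg_cst.
apply: cvgD; first by have := cl 1 x; under eq_fun do rewrite mul1r.
by have := cl (-1) x; under eq_fun do rewrite mulN1r.
Qed.

Lemma is_derive_cw_H p b x : -1 < x < 1 ->
  is_derive x 1 (cw_H p b) (b * p%:R * x ^+ p.-1 - artanh x).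
Proof.
move=> /andP[x1 x2].
have dp := is_derive_ln1D x1; have dm := is_derive_ln1B x2.
have d1 : is_derive x 1 (fun t : R => 1 + t) 1.
  by have := is_deriveD (is_derive_cst (1 : R) x 1) (is_derive_id x 1); rewrite add0r.
have d2 : is_derive x 1 (fun t : R => 1 - t) (-1).
  by have := is_deriveB (is_derive_cst (1 : R) x 1) (is_derive_id x 1); rewrite sub0r.
have dX : is_derive x 1 (fun t : R => t ^+ p) (p%:R * x ^+ p.-1).
  have := is_deriveX p (is_derive_id x (1 : R)).
  by rewrite exprfctE /GRing.scale /= mulr1.
have := is_deriveB (is_deriveZ b dX)
  (is_deriveZ 2^-1 (is_deriveD (is_deriveM d1 dp) (is_deriveM d2 dm))).
move/is_derive_eq; apply; rewrite /GRing.scale /= /artanh.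
set u := ln _; set v := ln _; field.
by apply/andP; split; apply/eqP; lra.
Qed.

Lemma artanh_gt0 x : 0 < x < 1 -> 0 < artanh x.
Proof.
move=> /andP[x0 x1]; rewrite /artanh mulr_gt0 // subr_gt0.
by apply: (@lt_trans _ _ 0); [apply: ln_lt0|apply: ln_gt0]; lra.
Qed.

Lemma artanh_unbounded M e : 0 <= e < 1 -> exists2 x, e < x < 1 & M < artanh x.
Proof.
(* The point [x = 1 - 2 / (y + 1)] satisfies [(1 + x) / (1 - x) = y], so [artanh x = ln y / 2]. The
   first summand of [y] pushes [artanh x] above [M], the second pushes [x] above [e]. *)
move=> /andP[e0 e1]; set y := expR (2 * M) + 2 / (1 - e).
have f1 : 0 < 1 - e by lra.
have k0 : 0 < 2 / (1 - e) by rewrite divr_gt0.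
have m0 := expR_gt0 (2 * M).
have y0 : 0 < y by rewrite addr_gt0.
have y1 : 0 < y + 1 by lra.
have p2 : 1 + (1 - 2 / (y + 1)) = 2 * (y / (y + 1)) by field; rewrite gt_eqF.
exists (1 - 2 / (y + 1)).
  rewrite ltrBrDr addrC -ltrBrDr; apply/andP; split; last first.
    by rewrite ltrBlDr ltrDl divr_gt0.
  rewrite ltr_pdivrMr // mulrC -ltr_pdivrMr //; rewrite /y; lra.
rewrite /artanh p2 subKr lnM ?posrE ?divr_gt0 // !ln_div ?posrE //.
have : ln (expR (2 * M)) < ln y by rewrite ltr_ln ?posrE // /y ltrDl.
rewrite expRK; lra.
Qed.

(* [g] is the function whose value at the sample mean is the maximum
   pseudolikelihood estimate, and [H' = p x^(p-1) (b - g)]. *)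
Definition mplfun p x : R := artanh x / (p%:R * x ^+ p.-1).

Lemma is_derive_mplfun p x : (1 < p)%N -> 0 < x < 1 ->
  is_derive x 1 (mplfun p)
    ((x - p.-1%:R * (1 - x ^+ 2) * artanh x) /
     (p%:R * x ^+ p * (1 - x ^+ 2))).
Proof.
case: p => [//|[//|q]] _ /andP[x0 x1].
have x' : -1 < x < 1 by lra.
have dX : is_derive x 1 (fun t : R => q.+2%:R * t ^+ q.+1) (q.+2%:R * (q.+1%:R * x ^+ q)).
  have := is_deriveZ q.+2%:R (is_deriveX q.+1 (is_derive_id x (1 : R))).
  by rewrite exprfctE /GRing.scale /= mulr1.
have X0 : 0 < x ^+ q by rewrite exprn_gt0.
have n0 : q.+2%:R * x ^+ q.+1 != 0 by rewrite mulf_neq0 // expf_neq0 // gt_eqF.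
have := is_deriveM (is_derive_artanh x') 
  (is_deriveV (f := fun t => q.+2%:R * t ^+ q.+1) n0 dX).
move/is_derive_eq; apply; rewrite /GRing.scale /= !exprS; move: (artanh x) => A.
move: X0; move: (x ^+ q) => X X0.
have q0 : 0 < q.+2%:R :> R by [].
move: q0; rewrite -[q.+2]addn1 natrD.
move: (q.+1%:R) => Q Q0.
by field; rewrite !gt_eqF //; nra.
Qed.

Lemma artanh_lt x y : -1 < x -> x < y -> y < 1 -> artanh x < artanh y.
Proof.
move=> x1 xy y1; rewrite /artanh ltr_pM2l ?invr_gt0 // ltrB // ltr_ln ?posrE; lra.
Qed.

(* Up to a positive factor, [v] is the derivative of [mplfun]; it is decreasing
   and then increasing, with [v 0 = 0] and [v 1 = 1]. *)
Lemma mplfun_derive_sign (q : R) (v := fun x => x - q * (1 - x ^+ 2) * artanh x) :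
  1 < q -> exists s, [/\ 0 < s < 1, forall x, 0 < x < s -> v x < 0
    & forall x, s < x < 1 -> 0 < v x].
Proof.
move=> q1.
have v0 : v 0 = 0 by rewrite /v artanh0 mulr0 subrr.
have v1 : v 1 = 1 by rewrite /v expr1n subrr mulr0 mul0r subr0.
have vc : continuous v.
  (* Distributing [1 - x^2] pairs each logarithm with the factor vanishing at its singularity, which
     makes [v] continuous at 1 and -1. *)
  have -> : v = (fun x => x - q / 2 * ((1 - x) * ((1 + x) * ln (1 + x))
                               - (1 + x) * ((1 - x) * ln (1 - x)))).
    by apply/funext => x; rewrite /v /artanh; field.
  have cD : continuous (fun x : R => 1 + x).
    by move=> x; apply: cvgD; [exact: cvg_cst|exact: cvg_id].
  have cB : continuous (fun x : R => 1 - x).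
    by move=> x; apply: cvgB; [exact: cvg_cst|exact: cvg_id].
  have cDl : continuous (fun x : R => (1 + x) * ln (1 + x)).
    by move=> x; apply: (@continuous_comp _ _ _ (fun x => 1 + x) (fun u => u * ln u));
      [exact: cD|exact: continuous_xlnx].
  have cBl : continuous (fun x : R => (1 - x) * ln (1 - x)).
    by move=> x; apply: (@continuous_comp _ _ _ (fun x => 1 - x) (fun u => u * ln u));
      [exact: cB|exact: continuous_xlnx].
  move=> x; apply: cvgB; first exact: cvg_id.
  apply: cvgM; first exact: cvg_cst.
  by apply: cvgB; apply: cvgM; [exact: cB|exact: cDl|exact: cD|exact: cBl].
have dv x : -1 < x < 1 -> is_derive x 1 v (2 * q * (x * artanh x) - (q - 1)).
  move=> x1.
  have dq : is_derive x 1 (fun t : R => q * (1 - t ^+ 2)) (q * (- (2 * x))).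
    have := is_deriveZ q (is_deriveB (is_derive_cst (1 : R) x 1)
      (is_deriveX 2 (is_derive_id x (1 : R)))).
    by rewrite exprfctE /GRing.scale /= mulr1 sub0r expr1.
  have := is_deriveB (is_derive_id x 1) (is_deriveM dq (is_derive_artanh x1)).
  move/is_derive_eq; apply; rewrite /GRing.scale /=; field.
  by case/andP: x1 => ? ?; rewrite gt_eqF //; nra.
have ac (a c : R) : -1 < a -> c < 1 -> {within `[a, c], continuous artanh}.
  move=> a1 c1; apply: (@is_derive_within_continuous artanh (fun x => (1 - x ^+ 2)^-1)) => x xac.
  by apply: is_derive_artanh; lra.
clearbody v.
(* Here [2 q X artanh X > q > q - 1], so the derivative of [v] is positive at [X]; it is negative at
   0, hence vanishes at some [z] between. *)
have [X X1 AX] : exists2 X, 2^-1 < X < 1 & 1 < artanh X.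
  by apply: artanh_unbounded; lra.
have [z z1 ez] : exists2 z, 0 < z < 1 & 2 * q * (z * artanh z) = q - 1.
  have wc : {within `[0, X], continuous (fun x => 2 * q * (x * artanh x))}.
    move=> x; apply: cvgM; first exact: cvg_cst.
    apply: cvgM; last by apply: ac; lra.
    exact: (continuous_subspaceT (fun x => cvg_id)).
  have X0 : 0 <= X by lra.
  have Xq : q - 1 <= 2 * q * (X * artanh X).
    have : 1 < 2 * (X * artanh X) by nra.
    by move: (X * artanh X) => w w1; nra.
  have [|z] := IVT (v := q - 1) X0 wc.
    rewrite mul0r mulr0 min_l ?max_r ?Xq ?andbT; lra.
  rewrite in_itv /= => /andP[z0 zX] ez; exists z => //.
  rewrite lt_neqAle z0 andbT (le_lt_trans zX) ?andbT; last by lra.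
  by apply/eqP => z00; move: ez; rewrite -z00 mul0r mulr0; lra.
have w_lt x y : 0 <= x -> x < y -> y < 1 -> x * artanh x < y * artanh y.
  move=> x0 xy y1; have := @artanh_lt x y; have := @artanh_gt0 y.
  have : 0 <= artanh x.
    by move: x0; rewrite le_eqVlt => /orP[/eqP<-|x0]; [rewrite artanh0|apply/ltW/artanh_gt0; lra].
  move: (artanh x) (artanh y) => A B A0 B0 AB.
  by have := B0 _; have := AB _ xy y1; nra.
have vz x : 0 < x <= z -> v x < 0.
  move=> /andP[x0 xz]; suff: - v 0 < - v x by rewrite v0 ltrN2.
  apply: (@gt0_derive_lt (fun t => - v t) (fun t => - (2 * q * (t * artanh t) - (q - 1)))) => //.
  - by move=> t tx; apply: is_deriveN; apply: dv; lra.
  - by apply: continuous_subspaceT => t; apply: cvgN; exact: vc.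
  - move=> t tx; rewrite -ez oppr_gt0 subr_lt0 ltr_pM2l; last by lra.
    by apply: w_lt; lra.
have vinc x y : z <= x -> x < y -> y <= 1 -> v x < v y.
  move=> zx xy y1.
  apply: (@gt0_derive_lt v (fun t => 2 * q * (t * artanh t) - (q - 1))) => //.
  - by move=> t tx; apply: dv; lra.
  - exact: continuous_subspaceT.
  - move=> t tx; rewrite -ez subr_gt0 ltr_pM2l; last by lra.
    by apply: w_lt; lra.
have z1' : z <= 1 by lra.
have vzl : v z < 0 by apply: vz; lra.
have [|s] := IVT (v := 0) z1' (continuous_subspaceT vc).
  by rewrite v1 min_l ?max_r ?ler01 ?andbT; lra.
rewrite in_itv /= => /andP[zs s1] es.
have s1' : s < 1.
  by rewrite lt_neqAle s1 andbT; apply/eqP => s1'; move: es; rewrite s1' v1; lra.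
exists s; split; first by lra.
  move=> x /andP[x0 xs]; have [xz|zx] := leP x z; first by apply: vz; lra.
  by rewrite -es vinc // ltW.
by move=> x /andP[sx x1]; rewrite -es vinc // ltW.
Qed.
End Artanh.

(** * Monotonicity of [cw_H] deduced from the valley shape of [mplfun] *)

Section Mplfun.
Context {R : realType} (p : nat) (hp : (3 <= p)%N).
Implicit Types (b h f e r x y z a c : R).
Local Notation g := (@mplfun R p).

Lemma cw_H0 b : cw_H p b 0 = 0.
Proof.
rewrite /cw_H addr0 subr0 ln1 mulr0 addr0 mulr0 subr0 expr0n.
by case: p hp => // q _; rewrite mulr0.
Qed.

Lemma mplfun_continuous a c : 0 < a -> c < 1 -> {within `[a, c], continuous g}.
Proof.
move=> a0 c1; apply: is_derive_within_continuous => x xac.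
by apply: is_derive_mplfun; [exact: leq_trans hp|lra].
Qed.

(** The minimizer [s] of [mplfun] solves a transcendental equation, so only the monotonicity on its
    two sides is recorded. *)
Definition mplfun_valley (s : R) := [/\ 0 < s, s < 1,
  forall x y, 0 < x -> x < y -> y <= s -> g y < g x
  & forall x y, s <= x -> x < y -> y < 1 -> g x < g y].

Lemma mplfun_valleyP : exists s, mplfun_valley s.
Proof.
have q1 : 1 < p.-1%:R :> R by rewrite ltr1n; case: p hp => [|[|[]]].
have p1 : (1 < p)%N by apply: leq_trans hp.
have [s [s01 neg pos]] := mplfun_derive_sign q1.
have den x : 0 < x < 1 -> 0 < p%:R * x ^+ p * (1 - x ^+ 2).
  move=> x01; rewrite !mulr_gt0 ?ltr0n ?exprn_gt0 //; first exact: ltnW.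
    by case/andP: x01.
  by rewrite subr_gt0 expr_lt1 //; lra.
have gc := mplfun_continuous.
exists s; case/andP: (s01) => s0 s1; split=> // x y.
- move=> x0 xy ys; rewrite -ltrN2.
  apply: (@gt0_derive_lt _ (fun t => - g t) (fun t => - ((t - p.-1%:R * (1 - t ^+ 2) * artanh t) /
     (p%:R * t ^+ p * (1 - t ^+ 2)))) _ _ xy).
  + by move=> t tx; apply: is_deriveN; apply: is_derive_mplfun => //; lra.
  + by move=> t; apply: cvgN; apply: gc; lra.
  + move=> t tx; rewrite oppr_gt0 pmulr_llt0 ?neg ?invr_gt0 ?den //; lra.
- move=> sx xy y1.
  apply: (@gt0_derive_lt _ g (fun t => ((t - p.-1%:R * (1 - t ^+ 2) * artanh t) /
     (p%:R * t ^+ p * (1 - t ^+ 2)))) _ _ xy).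
  + by move=> t tx; apply: is_derive_mplfun => //; lra.
  + by apply: gc; lra.
  + move=> t tx; rewrite divr_gt0 ?pos ?den //; lra.
Qed.

Lemma mplfun_gt0 x : 0 < x < 1 -> 0 < g x.
Proof.
move=> x01; rewrite /mplfun divr_gt0 ?artanh_gt0 // mulr_gt0 ?exprn_gt0 //; last by case/andP: x01.
by rewrite ltr0n; apply: leq_trans hp.
Qed.

Lemma mplfun_unbounded b e : 0 <= e < 1 -> exists2 x, e < x < 1 & b < g x.
Proof.
move=> e01; have [x xe bx] := artanh_unbounded (p%:R * `|b|) e01.
exists x => //; apply: le_lt_trans (ler_norm b) _.
have x0 : 0 < x by lra.
have p0 : 0 < p%:R :> R by rewrite ltr0n; apply: leq_trans hp.
rewrite ltr_pdivlMr ?mulr_gt0 ?exprn_gt0 //; apply: le_lt_trans bx.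
rewrite mulrCA mulrA -[leRHS]mulr1 ler_wpM2l //.
by apply: exprn_ile1; lra.
Qed.

Lemma cw_H_derive_sign b x : 0 < x < 1 ->
  b * p%:R * x ^+ p.-1 - artanh x = p%:R * x ^+ p.-1 * (b - g x).
Proof.
case/andP=> x0 _; rewrite /mplfun; field.
by rewrite pnatr_eq0 -lt0n expf_neq0 ?gt_eqF //; apply: leq_trans hp.
Qed.

Lemma cw_H_lt b x y : 0 <= x -> x < y -> y <= 1 ->
  (forall t, x < t < y -> g t < b) -> cw_H p b x < cw_H p b y.
Proof.
move=> x0 xy y1 gb.
apply: (@gt0_derive_lt _ _ (fun t => b * p%:R * t ^+ p.-1 - artanh t) _ _ xy).
- by move=> t txy; apply: is_derive_cw_H; lra.
- exact: continuous_subspaceT (@continuous_cw_H R p b).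
- move=> t txy; have t01 : 0 < t < 1 by lra.
  rewrite cw_H_derive_sign // mulr_gt0 ?subr_gt0 ?gb // mulr_gt0 ?exprn_gt0 //; last by lra.
  by rewrite ltr0n; apply: leq_trans hp.
Qed.

Lemma cw_H_gt b x y : 0 <= x -> x < y -> y <= 1 ->
  (forall t, x < t < y -> b < g t) -> cw_H p b y < cw_H p b x.
Proof.
move=> x0 xy y1 gb; rewrite -ltrN2.
apply: (@gt0_derive_lt _ (fun t => - cw_H p b t)
  (fun t => - (b * p%:R * t ^+ p.-1 - artanh t)) _ _ xy).
- by move=> t txy; apply: is_deriveN; apply: is_derive_cw_H; lra.
- by apply: continuous_subspaceT => t; apply: cvgN; exact: continuous_cw_H.
- move=> t txy; have t01 : 0 < t < 1 by lra.
  rewrite cw_H_derive_sign // -mulrN opprB mulr_gt0 ?subr_gt0 ?gb // mulr_gt0 ?exprn_gt0 //; last by lra.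
  by rewrite ltr0n; apply: leq_trans hp.
Qed.

Lemma cw_H_dec s b r x y : mplfun_valley s -> s <= r -> b <= g r -> r <= x -> x < y -> y <= 1 ->
  cw_H p b y < cw_H p b x.
Proof.
move=> [s0 s1 g_dec g_inc].
move=> sr br rx xy y1; apply: cw_H_gt => //; first lra.
by move=> t txy; apply: le_lt_trans br _; apply: g_inc; lra.
Qed.

Lemma cw_H_inc s b r x y : mplfun_valley s -> r < 1 -> g r <= b -> s <= x -> x < y -> y <= r ->
  cw_H p b x < cw_H p b y.
Proof.
move=> [s0 s1 g_dec g_inc].
move=> r1 br sx xy yr; apply: cw_H_lt => //; try lra.
by move=> t txy; apply: lt_le_trans br; apply: g_inc; lra.
Qed.

(** Left of [s], [b <= g x] forces [b < g] on all of []0, x[], so [cw_H] decreases there from its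
    value 0 at 0. *)
Lemma cw_H_le0 s b x : mplfun_valley s -> 0 <= x <= s -> (0 < x -> b <= g x) -> cw_H p b x <= 0.
Proof.
move=> [s0 s1 g_dec g_inc].
move=> /andP[x0 xs] bx; rewrite -(cw_H0 b).
move: x0; rewrite le_eqVlt => /orP[/eqP<- //|x0]; apply/ltW/cw_H_gt => //; first lra.
by move=> t /andP[t0 tx]; apply: le_lt_trans (bx x0) _; apply: g_dec.
Qed.

(** On [[0, r]], [cw_H] can only decrease first (while [g > b]) and increase afterwards, so its
    maximum over [[0, y]] sits at an endpoint. *)
Lemma cw_H_le_max s b r x y : mplfun_valley s -> r < 1 -> g r <= b -> s <= y <= r -> 0 <= x <= y ->
  cw_H p b x <= Num.max 0 (cw_H p b y).
Proof.
move=> vs; have [s0 s1 g_dec g_inc] := vs.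
move=> r1 rb /andP[sy yr] /andP[x0 xy].
have inc z : s <= z <= y -> cw_H p b z <= cw_H p b y.
  move=> /andP[sz]; rewrite le_eqVlt => /orP[/eqP<- //|zy].
  by apply/ltW/(@cw_H_inc s b r).
rewrite le_max; have [sx|xs] := leP s x; first by rewrite inc ?orbT // sx.
have [x00|x00] := leP x 0.
  by rewrite (@cw_H_le0 s) //; lra.
have [bx|xb] := leP b (g x); first by rewrite (@cw_H_le0 s) //; lra.
apply/orP; right; apply: le_trans (inc s _); last by lra.
apply/ltW/cw_H_lt => //; first lra.
by move=> t /andP[xt ts]; apply: lt_trans xb; apply: g_dec => //; lra.
Qed.

(** If [b <= g s], then [b <= g] everywhere and [cw_H <= 0], against the positive value at [z]. So
    [g s < b], and as [g] is unbounded near 1 it takes the value [b] at some [r > s]. The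
    comparisons on both sides of [r] transfer the positivity from [z] to [r]. *)
Lemma cw_H_argmax s b z : mplfun_valley s -> 0 <= z <= 1 -> 0 < cw_H p b z ->
  exists r, [/\ s < r < 1, g r = b & 0 < cw_H p b r].
Proof.
move=> vs; have [s0 s1 g_dec g_inc] := vs.
move=> z01 Hz.
have z0 : 0 < z.
  have /andP[] := z01; rewrite le_eqVlt => /orP[/eqP z0|//].
  by move: Hz; rewrite -z0 cw_H0 ltxx.
have sb : g s < b.
  rewrite ltNge; apply/negP => bs; move: Hz; apply/negP; rewrite -leNgt.
  have [zs|sz] := leP z s.
    apply: (@cw_H_le0 s) => //; first lra; move=> _; apply: le_trans bs _.
    by move: zs; rewrite le_eqVlt => /orP[/eqP-> //|zs]; apply/ltW/g_dec.
  apply: le_trans (_ : cw_H p b s <= 0); last by apply: (@cw_H_le0 s) => //; lra.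
  by apply/ltW/(@cw_H_dec s b s) => //; lra.
have [X sX bX] : exists2 x, s < x < 1 & b < g x by apply: mplfun_unbounded; lra.
have sX' : s <= X by lra.
have gc : {within `[s, X], continuous g} by apply: mplfun_continuous; lra.
have [|r] := IVT (v := b) sX' gc.
  by rewrite ge_min le_max (ltW sb) (ltW bX) orbT.
rewrite in_itv /= => /andP[sr rX] gr.
have sr' : s < r.
  by rewrite lt_neqAle sr andbT; apply/eqP => e; move: sb; rewrite e gr ltxx.
exists r; split => //; first lra.
have [zr|rz] := leP z r.
  have : cw_H p b z <= Num.max 0 (cw_H p b r).
    by apply: (@cw_H_le_max s b r) => //; rewrite ?gr //; lra.
  by rewrite le_max => /orP[|]; lra.
by apply: lt_trans Hz _; apply: (@cw_H_dec s b r) => //; lra.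
Qed.
End Mplfun.

(** * The maximum likelihood estimator *)

Section Mle.
Context {R : realType}.

(* [is_mle p x] is [is_argsup (fun c => cw_pmf p c x)]. *)
Definition is_argsup (L : R -> R) (b : \bar R) : Prop :=
  match b with
  | EFin r => forall c, L c <= L r
  | +oo%E => (forall c, L c < sup (range L)) /\ L c @[c --> +oo] --> sup (range L)
  | -oo%E => (forall c, L c < sup (range L)) /\ L c @[c --> -oo] --> sup (range L)
  end.

Lemma is_derive_bigsum (I : Type) (s : seq I) (h dh : I -> R -> R) (c : R) :
  (forall i, is_derive c 1 (h i) (dh i c)) ->
  is_derive c 1 (fun c => \sum_(i <- s) h i c) (\sum_(i <- s) dh i c).
Proof.
move=> hd; elim: s => [|i s IH].
  rewrite big_nil (_ : (fun _ => _) = cst 0); first exact: is_derive_cst.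
  by apply/funext => x; rewrite big_nil.
rewrite big_cons (_ : (fun _ => _) = h i + (fun c => \sum_(i <- s) h i c)).
  exact: is_deriveD.
by apply/funext => x; rewrite big_cons.
Qed.

Section ExponentialFamily.
Context {T : finType} (t : T -> R).
Implicit Types (x y z : T) (c : R).

(* The likelihood at the parameter [c] of the observation [x] in the
   exponential family with sufficient statistic [t]. *)
Definition partf x c : R := \sum_z expR (c * (t z - t x)).
Definition lik x c : R := (partf x c)^-1.

Lemma partf_ge x z c : expR (c * (t z - t x)) <= partf x c.
Proof.
rewrite /partf (bigD1 z) //= lerDl.
by apply: sumr_ge0 => i _; exact: expR_ge0.
Qed.

Lemma partf_gt0 x c : 0 < partf x c.
Proof. exact: lt_le_trans (expR_gt0 _) (partf_ge x x c). Qed.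

Lemma lik_gt0 x c : 0 < lik x c.
Proof. by rewrite invr_gt0 partf_gt0. Qed.

Lemma lik_le1 x c : lik x c <= 1.
Proof.
rewrite invf_le1 ?partf_gt0 //; apply: le_trans (partf_ge x x c).
by rewrite subrr mulr0 expR0.
Qed.

Lemma lik_lt x z c (m : R) : 0 < m -> m^-1 < c * (t z - t x) -> lik x c < m.
Proof.
move=> m0 mc; rewrite invf_plt ?posrE ?partf_gt0 //.
apply: lt_le_trans (le_trans (expR_ge1Dx _) (partf_ge x z c)); lra.
Qed.

(** The term of [y] in [partf x] drives the likelihood to 0 at [+oo], so the limit there is not the
    positive supremum. *)
Lemma lik_argsup_neqy x y b : t x < t y -> is_argsup (lik x) b -> b != +oo%E.
Proof.
move=> xy; case: b => // -[lt0 cv]; exfalso.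
set l := sup _ in lt0 cv.
have l0 : 0 < l := lt_trans (lik_gt0 x 0) (lt0 0).
have l2 : 0 < l / 2 by lra.
have : \forall c \near +oo, l / 2 < lik x c by apply: (cvgr_gt l) => //; lra.
move=> nl; have [c] := filter_ex (filterI nl (nbhs_pinfty_gt (num_real ((l / 2)^-1 / (t y - t x))))).
move=> [/= H1]; rewrite ltr_pdivrMr ?subr_gt0 // => /(lik_lt l2) H2.
by have := lt_trans H1 H2; rewrite ltxx.
Qed.

Lemma lik_argsup_neqNy x y b : t y < t x -> is_argsup (lik x) b -> b != -oo%E.
Proof.
move=> xy; case: b => // -[lt0 cv]; exfalso.
set l := sup _ in lt0 cv.
have l0 : 0 < l := lt_trans (lik_gt0 x 0) (lt0 0).
have l2 : 0 < l / 2 by lra.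
have : \forall c \near -oo, l / 2 < lik x c by apply: (cvgr_gt l) => //; lra.
move=> nl; have [c] := filter_ex (filterI nl (nbhs_ninfty_lt (num_real (- ((l / 2)^-1 / (t x - t y)))))).
move=> [/= H1]; rewrite ltrNr ltr_pdivrMr ?subr_gt0 // mulNr -mulrN opprB => /(lik_lt l2) H2.
by have := lt_trans H1 H2; rewrite ltxx.
Qed.

Lemma is_derive_partf x c :
  is_derive c 1 (partf x) (\sum_z (t z - t x) * expR (c * (t z - t x))).
Proof.
apply: (@is_derive_bigsum _ _ (fun z c => expR (c * (t z - t x)))
  (fun z c => (t z - t x) * expR (c * (t z - t x)))) => z.
have d : is_derive c 1 (fun c => c * (t z - t x)) (t z - t x).
  have := is_deriveM (is_derive_id c 1) (is_derive_cst (t z - t x) c 1).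
  by rewrite /GRing.scale /= mulr0 add0r mulr1.
have := is_derive1_comp (f := expR) (is_derive_expR _) d.
by rewrite mulrC.
Qed.

Lemma lik_mulE x y c : lik y c = expR (c * (t y - t x)) * lik x c.
Proof.
apply: (@mulIf _ (partf y c * partf x c)).
  by rewrite mulf_neq0 // gt_eqF // partf_gt0.
rewrite mulrA mulVf ?gt_eqF ?partf_gt0 // mul1r mulrACA mulrA.
rewrite mulfVK ?gt_eqF ?partf_gt0 // /partf mulr_sumr; apply: eq_bigr => z _.
by rewrite -expRD; congr expR; ring.
Qed.

(** The likelihood equation, saying that the mean of [t] under the parameter [c] is [t x]: a
    maximizer of [lik x] minimizes [partf x]. *)
Lemma lik_max_critical x c : (forall c', lik x c' <= lik x c) ->
  \sum_z (t z - t x) * expR (c * (t z - t x)) = 0.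
Proof.
move=> mx; have d := is_derive_partf x c.
have dd c' : derivable (partf x) c' 1 by case: (is_derive_partf x c').
have : is_derive c 1 (partf x) 0.
  apply: (@derive1_at_min _ (partf x) (c - 1) (c + 1) c) => //; first lra.
    by rewrite in_itv /=; apply/andP; split; lra.
  by move=> c2 _; rewrite -lef_pV2 ?posrE ?partf_gt0 //; exact: mx.
by move=> [_ e1]; have [_ <-] := d; rewrite e1.
Qed.

(** The likelihood ratio [lik y / lik x] increases with the parameter, whence [u <= v] for finite
    maximizers. Equality would make both likelihood equations hold at one parameter and force
    [t x = t y]. *)
Lemma lik_argsup_lt x y u v : t x < t y ->
  is_argsup (lik x) u -> is_argsup (lik y) v -> (u < v)%E.
Proof.
move=> xy mu mv; have := lik_argsup_neqy xy mu; have := lik_argsup_neqNy xy mv.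
move: u v mu mv => [u| |] [v| |] //= mu mv _ _; rewrite ?ltry ?ltNyr //.
have D0 : 0 < t y - t x by rewrite subr_gt0.
have uv : u <= v.
  rewrite leNgt; apply/negP => vu; have := mv u; apply/negP.
  rewrite -ltNge !(lik_mulE x y); apply: (@lt_le_trans _ _ (expR (u * (t y - t x)) * lik x v)).
    by rewrite ltr_pM2r ?lik_gt0 // ltr_expR ltr_pM2r.
  by rewrite ler_pM2l ?expR_gt0.
rewrite lte_fin lt_neqAle uv andbT; apply/eqP => e; rewrite -{v uv}e in mv.
have := lik_max_critical mv; have := lik_max_critical mu.
have -> : \sum_z (t z - t y) * expR (u * (t z - t y)) =
  expR (- (u * (t y - t x))) * (\sum_z (t z - t x) * expR (u * (t z - t x)) -
  (t y - t x) * partf x u).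
  rewrite /partf mulr_sumr -sumrB mulr_sumr; apply: eq_bigr => z _.
  rewrite -mulrBl mulrCA -expRD; congr (_ * expR _); ring.
move=> -> /eqP; apply/negP; rewrite sub0r mulf_neq0 ?oppr_eq0 ?mulf_neq0 ?gt_eqF ?expR_gt0 ?partf_gt0 //.
Qed.

Lemma lik_argsup_exists (x0 y0 : T) : t x0 != t y0 ->
  forall x, exists b, is_argsup (lik x) b.
Proof.
move=> ne x.
have rub : ubound (range (lik x)) 1 by move=> _ [c _ <-]; exact: lik_le1.
have hs : has_sup (range (lik x)) by split; [exists (lik x 0), 0|exists 1].
have ub c : lik x c <= sup (range (lik x)) by apply: ub_le_sup; [exists 1|exists c].
have [z neqz] : exists z, t z != t x.
  have [e|] := eqVneq (t x0) (t x); last by exists x0.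
  by exists y0; rewrite eq_sym -e.
(* If [t x] is the largest (smallest) value of [t], the likelihood is strictly monotone and its
   supremum is approached at [+oo] ([-oo]). Otherwise it decays on both sides and a maximizer is
   found on a compact interval. *)
have [/existsP[z1 h1]|/existsPn no1] := boolP [exists z, t x < t z]; last first.
  have zx : t z < t x by rewrite lt_neqAle neqz leNgt no1.
  have mono c c' : c < c' -> lik x c < lik x c'.
    move=> cc; rewrite ltf_pV2 ?posrE ?partf_gt0 //.
    rewrite /partf (bigD1 z) //= [ltRHS](bigD1 z) //= ltr_leD //.
      by rewrite ltr_expR ltr_nM2r // subr_lt0.
    apply: ler_sum => i _; rewrite ler_expR ler_wnM2r ?subr_le0 //; last exact: ltW.
    by rewrite leNgt no1.
  exists +oo%E; split; first by move=> c; apply: lt_le_trans (ub (c + 1)); apply: mono; lra.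
  apply/cvgrPdist_lt => e e0.
  have [_ [c0 _ <-] c0e] := sup_adherent e0 hs.
  near=> c; rewrite ger0_norm ?subr_ge0 // ltrBlDr -ltrBlDl.
  apply: lt_trans c0e _; apply: mono; near: c; apply: nbhs_pinfty_gt; exact: num_real.
have [/existsP[z2 h2]|/existsPn no2] := boolP [exists z, t z < t x]; last first.
  have zx : t x < t z by rewrite lt_neqAle eq_sym neqz leNgt no2.
  have mono c c' : c' < c -> lik x c < lik x c'.
    move=> cc; rewrite ltf_pV2 ?posrE ?partf_gt0 //.
    rewrite /partf (bigD1 z) //= [ltRHS](bigD1 z) //= ltr_leD //.
      by rewrite ltr_expR ltr_pM2r // subr_gt0.
    apply: ler_sum => i _; rewrite ler_expR ler_wpM2r ?subr_ge0 //; last exact: ltW.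
    by rewrite leNgt no2.
  exists -oo%E; split; first by move=> c; apply: lt_le_trans (ub (c - 1)); apply: mono; lra.
  apply/cvgrPdist_lt => e e0.
  have [_ [c0 _ <-] c0e] := sup_adherent e0 hs.
  near=> c; rewrite ger0_norm ?subr_ge0 // ltrBlDr -ltrBlDl.
  apply: lt_trans c0e _; apply: mono; near: c; apply: nbhs_ninfty_lt; exact: num_real.
have D1 : 0 < t z1 - t x by rewrite subr_gt0.
have D2 : 0 < t x - t z2 by rewrite subr_gt0.
(* By [lik_lt], the likelihood outside [[- K2, K1]] is below its value at 0. *)
set K1 := (lik x 0)^-1 / (t z1 - t x); set K2 := (lik x 0)^-1 / (t x - t z2).
have lx : 0 < (lik x 0)^-1 by rewrite invr_gt0 lik_gt0.
have K10 : 0 <= K1 by exact/ltW/divr_gt0.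
have K20 : 0 <= K2 by exact/ltW/divr_gt0.
have pc : {within `[- K2, K1], continuous (partf x)}.
  apply: derivable_within_continuous => c _; by case: (is_derive_partf x c).
have K12 : - K2 <= K1 by lra.
have [r _ rmin] := EVT_min K12 pc.
exists r%:E => c; have [cK|cK] := boolP (c \in `[- K2, K1]).
  by rewrite lef_pV2 ?posrE ?partf_gt0 // rmin.
apply: (@le_trans _ _ (lik x 0)); last first.
  by rewrite lef_pV2 ?posrE ?partf_gt0 // rmin // in_itv /=; apply/andP; split; lra.
apply: ltW; move: cK; rewrite in_itv /= negb_and -!ltNge => /orP[].
  by rewrite ltrNr ltr_pdivrMr // mulNr -mulrN opprB => /(lik_lt (lik_gt0 x 0)).
by rewrite ltr_pdivrMr // => /(lik_lt (lik_gt0 x 0)).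
Unshelve. all: by end_near. Qed.
End ExponentialFamily.

Lemma mle_lt p n (x y : config n) : (0 < n)%N ->
  xbar x ^+ p < xbar y ^+ p :> R -> (mle p x < mle p y :> \bar R)%E.
Proof.
move=> n0 xy; pose t (z : config n) : R := n%:R * xbar z ^+ p.
have txy : t x < t y by rewrite ltr_pM2l // ltr0n.
have likE (z : config n) : (fun c => cw_pmf p c z) = lik t z.
  apply/funext => c; rewrite /cw_pmf /cw_Z mulVKf ?expf_neq0 //.
  rewrite -[LHS]invrK invf_div; congr _^-1; rewrite /partf mulr_suml.
  apply: eq_bigr => w _; rewrite !cw_weightE // -expRB /t; congr expR; ring.
have mleP (z : config n) : is_argsup (lik t z) (mle p z).
  (* As [t x] and [t y] differ, a maximizer exists and [xget] does not fall back on its default. *)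
  rewrite -likE; apply: (@xgetPex _ 0%E [set b | is_mle p z b]).
  have [b] := lik_argsup_exists (negbT (lt_eqF txy)) z.
  by rewrite -likE; exists b.
exact: lik_argsup_lt txy (mleP x) (mleP y).
Qed.
End Mle.

(** * Bahadur slopes from large deviations *)

Section Criterion.
Context {R : realType}.
Implicit Types (b h f e : R).

Lemma ups_surj n k : (k <= n)%N -> exists y : config n, ups y = k.
Proof.
move=> kn; have : (0 < #|[set y : config n | ups y == k]%SET|)%N by rewrite card_ups bin_gt0.
by move=> /card_gt0P[y]; rewrite inE => /eqP; exists y.
Qed.

Lemma xbar_dense (a c : R) : -1 <= a -> a < c -> c <= 1 ->
  \forall n \near \oo, exists y : config n, a < xbar y < c.
Proof.
move=> a1 ac c1; near=> n.
have d0 : 0 < c - a by rewrite subr_gt0.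
have nd : 2 / (c - a) < n%:R by near: n; exact: nbhs_infty_gtr.
have n0' : 0 < n%:R :> R by apply: lt_trans nd; rewrite divr_gt0.
have n0 : (0 < n)%N by rewrite -(ltr_nat R).
(* [t] up spins would give the mean [a]. Means are spaced by [2 / n < c - a], so the next integer
   count lands strictly between [a] and [c]. *)
set t := n%:R * (1 + a) / 2; have t0 : 0 <= t.
  by rewrite /t divr_ge0 // mulr_ge0 //; lra.
have /andP[kt tk] := Num.Theory.truncn_itv t0.
set k := (Num.truncn t) in kt tk.
have H : a < 2 * k.+1%:R / n%:R - 1 < c.
  have k1 : (k.+1%:R : R) <= t + 1 by rewrite -natr1 lerD2r.
  rewrite ltrBrDr ltr_pdivlMr // ltrBlDr ltr_pdivrMr //.
  have nd' : 2 < n%:R * (c - a) by rewrite -ltr_pdivrMr.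
  move: nd' k1 tk; rewrite /t; move: (n%:R : R) (k.+1%:R : R) => N K nd' k1 tk.
  by apply/andP; split; lra.
have kn : (k.+1 <= n)%N.
  have /andP[_] := H; rewrite ltrBlDr ltr_pdivrMr // -(ler_nat R).
  by move: (n%:R : R) (k.+1%:R : R) n0' => N K N0 H'; nra.
by have [y yk] := ups_surj kn; exists y; rewrite xbarE // yk.
Unshelve. all: by end_near. Qed.

Lemma sqr_le_expR e : 0 < e -> \forall n \near \oo, n.+1%:R ^+ 2 <= expR (n%:R * e).
Proof.
move=> e0; near=> n.
have ne : 16 / e ^+ 2 < n%:R by near: n; exact: nbhs_infty_gtr.
(* With [u = n e / 4], [expR (4 u) >= (1 + u)^4], and [(1 + u)^2 >= n + 1] once [n e^2 >= 16]. *)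
have -> : n%:R * e = (2 * 2)%:R * (n%:R * e / 4) by field.
have v0 : 0 <= n%:R * e / 4 by have := mulr_ge0 (ler0n R n) (ltW e0); lra.
rewrite expRM_natl exprM.
apply: lerXn2r; rewrite ?nnegrE ?exprn_ge0 ?expR_ge0 //.
apply: (@le_trans _ _ ((1 + n%:R * e / 4) ^+ 2)); last first.
  apply: lerXn2r; rewrite ?nnegrE ?expR_ge0 ?expR_ge1Dx //; lra.
move: ne; rewrite ltr_pdivrMr ?exprn_gt0 // -(natr1 n).
have : 0 <= n%:R :> R by [].
move: (n%:R : R) => N N0 H.
have : N * 16 <= N * (N * e ^+ 2) by apply: ler_wpM2l => //; exact: ltW.
have : 0 <= N * e by apply: mulr_ge0 => //; exact: ltW.
rewrite expr2; nra.
Unshelve. all: by end_near. Qed.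

Lemma test_stat_le (T : estimator R) b0 n (x y : config n) : (0 < n)%N ->
  (test_stat T b0 y <= test_stat T b0 x)%E = (T n y <= T n x)%E.
Proof.
move=> n0; rewrite /test_stat lee_pmul2l //; last first.
  by rewrite lte_fin sqrtr_gt0 ltr0n.
by rewrite leeD2rE.
Qed.

(** The level is the [b0]-probability of a strictly larger estimate. With [F] the supremum of
    [cw_H p b0] and [h] its supremum, up to [e], over the samples beating the observed one, it is
    [exp (n (h - F))] up to subexponential factors. Control is needed only on events [A n] whose
    probability under [b] tends to 1. As [T] depends on the mean only, the whole type class of the
    witness [y] contributes to the lower bound. *)
Lemma bahadur_slope_criterion p (T : estimator R) b0 b (F h : R) :
  (forall n (x y : config n), xbar x = xbar y :> R -> T n x = T n y) ->
  (forall n (y : config n), (0 < n)%N -> cw_H p b0 (xbar y) <= F) ->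
  (forall e, 0 < e -> \forall n \near \oo,
     exists z : config n, F - e <= cw_H p b0 (xbar z)) ->
  (forall e, 0 < e -> exists A : forall n, pred (config n),
     cw_Pr p b (predC (A n)) @[n --> \oo] --> (0 : R) /\
     \forall n \near \oo, forall x : config n, A n x ->
       (forall y, (T n x < T n y)%E -> cw_H p b0 (xbar y) <= h + e) /\
       (exists2 y, (T n x < T n y)%E & h - e <= cw_H p b0 (xbar y))) ->
  is_bahadur_slope p T b0 b (2 * (F - h)).
Proof.
move=> Tx HF FH AT e e0; have e4 : 0 < e / 4 by lra.
have [A [A0 nA]] := AT _ e4.
apply: (squeeze_cvgr _ (cvg_cst (0 : R)) A0).
have nF := FH _ e4; have nP := sqr_le_expR e4.
near=> n; rewrite cw_Pr_ge0 /=; apply: cw_Pr_le_sub => x /=.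
apply: contraTN => Ax; rewrite -leNgt.
have n0 : (0 < n)%N by near: n; exact: nbhs_infty_gt.
have n0' : 0 < n%:R :> R by rewrite ltr0n.
have /(_ _ x Ax)[//|U [y Txy Hy]] := near nA n.
have /(_ _)[//|z Hz] := near nF n.
have P2 : n.+1%:R ^+ 2 <= expR (n%:R * (e / 4)) by near: n.
rewrite /attained_level /test_cdf cw_PrC.
set B := predC _; set L := cw_Pr _ _ B.
have Bw w : B w = (T n x < T n w)%E by rewrite /B /= test_stat_le // ltNge.
have up : L <= expR (n%:R * (h - F + 3 * (e / 4))).
  apply: (@le_trans _ _ (n.+1%:R ^+ 2 * expR (n%:R * (h + e / 4 - (F - e / 4))))).
    by apply: cw_Pr_le n0 _ Hz => w; rewrite Bw => /U.
  apply: le_trans (_ : expR (n%:R * (e / 4)) * expR (n%:R * (h + e / 4 - (F - e / 4))) <= _).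
    by rewrite ler_pM2r ?expR_gt0.
  by rewrite -expRD ler_expR -mulrDr ler_pM2l //; lra.
have lo : expR (n%:R * (h - F - 2 * (e / 4))) <= L.
  have yB w : ups w = ups y -> B w.
    by move=> wy; rewrite Bw (Tx n w y) // !xbarE // wy.
  have H := cw_Pr_ge n0 yB Hy (fun w => HF n w n0).
  have : expR (n%:R * (h - e / 4 - F)) <= expR (n%:R * (e / 4)) * L.
    by apply: le_trans H _; rewrite ler_wpM2r // cw_Pr_ge0.
  rewrite -ler_pdivrMl ?expR_gt0 // -expRN -expRD; apply: le_trans.
  by rewrite ler_expR; lra.
have L0 : 0 < L by apply: lt_le_trans lo; exact: expR_gt0.
rewrite (lt_geF L0) /=.
have l1 : n%:R^-1 * ln L <= h - F + 3 * (e / 4).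
  by rewrite ler_pdivrMl // -[leRHS]expRK ler_ln ?posrE ?expR_gt0.
have l2 : h - F - 2 * (e / 4) <= n%:R^-1 * ln L.
  by rewrite ler_pdivlMl // -[leLHS]expRK ler_ln ?posrE ?expR_gt0.
rewrite lee_fin ler_norml.
by move: (_ * ln L) l1 l2 => l l1 l2; apply/andP; split; lra.
Unshelve. all: by end_near. Qed.

(** The limits [- c / 2] and [- c' / 2] are [|c - c'| / 2] apart, so at tolerance [|c - c'| / 8] the
    two exceptional events cover all samples, yet both eventually have probability below 1/2. *)
Lemma is_bahadur_slope_inj p (T : estimator R) b0 b c c' :
  is_bahadur_slope p T b0 b c -> is_bahadur_slope p T b0 b c' -> c = c'.
Proof.
move=> Hc Hc'; apply/eqP; apply: contraT => ne.
have d0 : 0 < `|c - c'| / 8 by rewrite divr_gt0 // normr_gt0 subr_eq0.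
have /cvgr_lt/(_ 2^-1) h1 := Hc _ d0; have /cvgr_lt/(_ 2^-1) h2 := Hc' _ d0.
have half : (0 : R) < 2^-1 by rewrite invr_gt0.
have [n [/=]] := filter_ex (filterI (h1 half) (h2 half)).
 set A := (X in cw_Pr _ _ X < _); set A' := (X in _ -> is_true (cw_Pr _ _ X < _) -> _).
move=> H1 H2.
have : cw_Pr p b (predC A) <= cw_Pr p b A'.
  apply: cw_Pr_le_sub => x; rewrite /A /A' /=; rewrite -leNgt.
  set l := (_ * _)%E; case: l => [l| |] //=.
  rewrite ?lee_fin ?lte_fin => H.
  have : `|c - c'| <= 2 * (`|l - - (2^-1 * c)| + `|l - - (2^-1 * c')|).
    have -> : c - c' = 2 * ((l - - (2^-1 * c)) - (l - - (2^-1 * c'))) by field.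
    by rewrite normrM ger0_norm // ler_pM2l // ler_normB.
  move: d0 H; move: `|_ - _| `|_ - _| `|_ - _| => u v w; lra.
rewrite -cw_PrC; lra.
Qed.
End Criterion.

(** * Concentration of the sample mean above the threshold *)

Section Concentration.
Context {R : realType} (p : nat) (hp : (3 <= p)%N).
Implicit Types (b e r s x y z d : R).
Local Notation g := (@mplfun R p).

Lemma cw_H_abs b x : 0 <= x ^+ p -> cw_H p b x = cw_H p b `|x|.
Proof.
move=> xp; rewrite /cw_H -normrX (ger0_norm xp).
case: (ler0P x) => // _; rewrite !opprK.
by congr (_ - _ * _); rewrite addrC.
Qed.

Lemma cw_H_b0_le0 x : -1 <= x <= 1 -> cw_H p 0 x <= 0.
Proof.
have pos y : 0 <= y <= 1 -> cw_H p 0 y <= 0.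
  move=> /andP[]; rewrite le_eqVlt => /orP[/eqP<- _|y0 y1]; first by rewrite cw_H0.
  have : cw_H p 0 y < cw_H p 0 0.
    by apply: (cw_H_gt hp) => // t ty; apply: (mplfun_gt0 hp); lra.
  by rewrite cw_H0 // => /ltW.
move=> x1; have [x0|x0] := leP 0 x; first by apply: pos; lra.
suff -> : cw_H p 0 x = cw_H p 0 (- x) by apply: pos; lra.
by rewrite /cw_H !mul0r opprK; congr (_ - _ * _); rewrite addrC.
Qed.

Lemma cw_HE b x : cw_H p b x = b * x ^+ p + cw_H p 0 x.
Proof. by rewrite /cw_H mul0r sub0r. Qed.

Lemma cw_H_neg b x : 0 <= b -> -1 <= x <= 1 -> x ^+ p < 0 -> cw_H p b x <= 0.
Proof.
move=> b0 x1 xp; rewrite cw_HE.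
have := cw_H_b0_le0 x1; have := mulr_ge0_le0 b0 (ltW xp); lra.
Qed.

Lemma cw_H_le_argmax s b r x : mplfun_valley p s -> 0 <= b -> s < r < 1 -> g r = b ->
  0 < cw_H p b r -> -1 <= x <= 1 -> cw_H p b x <= cw_H p b r.
Proof.
move=> vs b0 sr gr Hr x1; have [s0 s1 _ _] := vs.
have [xp|xp] := ltP (x ^+ p) 0; first by apply: le_trans (cw_H_neg _ _ _) (ltW Hr).
rewrite cw_H_abs //; have x0 := normr_ge0 x.
have x1' : `|x| <= 1 by rewrite ler_norml.
have [xr|rx] := leP `|x| r; last by apply/ltW/(cw_H_dec hp vs (r := r)); rewrite ?gr //; lra.
rewrite -[leRHS](max_idPr (ltW Hr)).
by apply: (cw_H_le_max hp vs (r := r)); rewrite ?gr //; lra.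
Qed.

Lemma cw_H_near b x e : 0 < e ->
  exists2 d, 0 < d & forall y, `|y - x| <= d -> `|cw_H p b y - cw_H p b x| <= e.
Proof.
move=> e0; have /cvgrPdist_le/(_ _ e0) := @continuous_cw_H R p b x.
rewrite near_nbhs => /nbhs_normP[d /= d0 H]; exists (d / 2); first lra.
move=> y yd; rewrite distrC; apply: H; rewrite /ball_ /= distrC; lra.
Qed.

Lemma cw_H_dense b x e : 0 <= x < 1 -> 0 < e ->
  \forall n \near \oo, exists z : config n, cw_H p b x - e <= cw_H p b (xbar z).
Proof.
move=> /andP[x0 x1] e0; have [d d0 dH] := cw_H_near b x e0.
have xm : x < Num.min (x + d) 1 by rewrite lt_min x1 ltrDl d0.
near=> n; have [z] : exists z : config n, x < xbar z < Num.min (x + d) 1.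
  near: n; apply: xbar_dense => //; [lra|by rewrite ge_min lexx orbT].
rewrite lt_min => /and3P[xz zd _]; exists z.
have zd' : `|xbar z - x| <= d by rewrite ger0_norm; lra.
by have := dH _ zd'; rewrite ler_norml => /andP[]; lra.
Unshelve. all: by end_near. Qed.

(** The sign condition holds always for even [p] and means [0 <= xbar x] for odd [p], so both
    parities are treated at once. *)
Definition near_mean r e n (x : config n) : bool :=
  (0 <= (xbar x : R) ^+ p) && (`| `|xbar x| - r| < e).

(** Clipping [r - e] and [r + e] to [[s, 1]] gives [y1] and [y2]; away from the window [cw_H] is at
    most its largest value at 0, [y1] and [y2], each below the value at [r]. *)
Lemma cw_H_far s b r e : mplfun_valley p s -> 0 <= b -> s < r < 1 -> g r = b ->
  0 < cw_H p b r -> 0 < e ->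
  exists2 d, 0 < d & forall x, -1 <= x <= 1 ->
    ~~ ((0 <= x ^+ p) && (`| `|x| - r| < e)) -> cw_H p b x <= cw_H p b r - d.
Proof.
move=> vs b0 sr gr Hr e0; have [s0 s1 _ _] := vs.
pose y1 := Num.max s (r - e); pose y2 := Num.min 1 (r + e).
have [y1s y1r] : s <= y1 /\ y1 < r by rewrite le_max lexx gt_max; split => //; lra.
have y1e : r - e <= y1 by rewrite le_max lexx orbT.
have [y21 y2r] : y2 <= 1 /\ r < y2 by rewrite ge_min lexx lt_min; split => //; lra.
have y2e : y2 <= r + e by rewrite ge_min lexx orbT.
clearbody y1 y2.
have H1 : cw_H p b y1 < cw_H p b r by apply: (cw_H_inc hp vs (r := r)); rewrite ?gr //; lra.
have H2 : cw_H p b y2 < cw_H p b r by apply: (cw_H_dec hp vs (r := r)); rewrite ?gr //; lra.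
pose m := Num.max (Num.max 0 (cw_H p b y1)) (cw_H p b y2).
exists (cw_H p b r - m); first by rewrite subr_gt0 !gt_max Hr H1.
move=> x x1; rewrite subKr negb_and -ltNge -leNgt => /orP[xp|].
  by rewrite !le_max cw_H_neg.
have [xp _|xp] := ltP (x ^+ p) 0; first by rewrite !le_max cw_H_neg.
rewrite cw_H_abs //; have x0 := normr_ge0 x.
have x1' : `|x| <= 1 by rewrite ler_norml.
rewrite /m le_max; have [xr|rx] := leP `|x| r.
  rewrite ler0_norm ?subr_le0 // => xe; apply/orP; left.
  by apply: (cw_H_le_max hp vs (r := r)); rewrite ?gr //; lra.
rewrite gtr0_norm ?subr_gt0 // => xe; apply/orP; right.
have : y2 <= `|x| by lra.
rewrite le_eqVlt => /orP[/eqP-> //|y2x].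
by apply/ltW/(cw_H_dec hp vs (r := r)); rewrite ?gr //; lra.
Qed.

(** Means outside the window lose at least [d] in the exponent. Approximating [r] by an actual mean
    and absorbing the polynomial factor cost [d / 3] each, leaving [exp (- n d / 3)]. *)
Lemma concentration s b r e : mplfun_valley p s -> 0 <= b -> s < r < 1 -> g r = b ->
  0 < cw_H p b r -> 0 < e ->
  cw_Pr p b (predC (@near_mean r e n)) @[n --> \oo] --> (0 : R).
Proof.
move=> vs b0 sr gr Hr e0; have [s0 s1 _ _] := vs.
have [d d0 far] := cw_H_far vs b0 sr gr Hr e0.
have d3 : 0 < d / 3 by lra.
have r01 : 0 <= r < 1 by lra.
have dense := cw_H_dense b r01 d3; have poly := sqr_le_expR d3.
apply/cvgrPdist_lt => e1 e10; near=> n.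
rewrite sub0r normrN ger0_norm ?cw_Pr_ge0 //.
have n0 : (0 < n)%N by near: n; exact: nbhs_infty_gt.
have /(_ _)[//|z Hz] := near dense n.
have P2 : n.+1%:R ^+ 2 <= expR (n%:R * (d / 3)) by near: n.
have A (w : config n) : predC (@near_mean r e n) w -> cw_H p b (xbar w) <= cw_H p b r - d.
  by move=> /= ?; apply: far => //; exact: xbar_itv.
apply: le_lt_trans (cw_Pr_le n0 A Hz) _.
have nb : e1^-1 / (d / 3) < n%:R by near: n; exact: nbhs_infty_gtr.
apply: (@le_lt_trans _ _ (expR (- (n%:R * (d / 3))))).
  have := ler_wpM2r (expR_ge0 (n%:R * (cw_H p b r - d - (cw_H p b r - d / 3)))) P2.
  move/le_trans; apply; rewrite -expRD ler_expR; lra.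
rewrite expRN invf_plt ?posrE ?expR_gt0 //.
apply: lt_le_trans (expR_ge1Dx _).
by move: nb; rewrite ltr_pdivrMr //; lra.
Unshelve. all: by end_near. Qed.

End Concentration.

(** * The maximum pseudolikelihood estimator *)

Section Mple.
Context {R : realType} (p : nat) (hp : (3 <= p)%N).
Implicit Types (b e r s x y z d : R).
Local Notation g := (@mplfun R p).

Lemma config_eq0 (x y : config 0) : x = y.
Proof. by apply/ffunP => -[]. Qed.

(** Equal likelihood functions give equal sets of maximizers, on which [xget] makes the same
    choice. *)
Lemma mle_eq n (x y : config n) : (xbar x : R) ^+ p = xbar y ^+ p ->
  mle p x = mle p y :> \bar R.
Proof.
case: n x y => [|n] x y xy; first by rewrite (config_eq0 x y).
congr xget; apply/funext => b.
change (is_argsup (fun c : R => cw_pmf p c x) b = is_argsup (fun c : R => cw_pmf p c y) b).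
congr is_argsup; apply/funext => c; rewrite /cw_pmf !cw_weightE //.
by rewrite xy.
Qed.

Lemma mple_eq n (x y : config n) : (xbar x : R) = xbar y -> mple p x = mple p y :> \bar R.
Proof. by rewrite /mple => ->. Qed.

Lemma mle_ltE n (x y : config n) : (0 < n)%N ->
  (mle p x < mle p y :> \bar R)%E = ((xbar x : R) ^+ p < xbar y ^+ p).
Proof.
move=> n0; apply/idP/idP; last exact: mle_lt.
apply: contraTT; rewrite -!leNgt le_eqVlt => /orP[/eqP e|/(mle_lt n0)/ltW //].
by rewrite (mle_eq e).
Qed.

Lemma mple_coefE x : x != 0 -> p%:R^-1 * x ^ (1 - p%:Z) = x / (p%:R * x ^+ p).
Proof.
move=> x0; rewrite expfzDr // expr1z -invr_expz -exprnP.
have := expf_neq0 p x0; move: (x ^+ p) => X X0.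
have p0 : p%:R != 0 :> R by rewrite pnatr_eq0 -lt0n; apply: leq_trans hp.
by field; rewrite X0.
Qed.

Lemma mplfunE x : 0 < x -> g x = artanh x * x / (p%:R * x ^+ p).
Proof.
move=> x0; rewrite /mplfun; have -> : x ^+ p = x * x ^+ p.-1.
  by rewrite -exprS prednK //; apply: leq_trans hp.
have := expf_neq0 p.-1 (lt0r_neq0 x0); move: (x ^+ _) => X X0.
have p0 : p%:R != 0 :> R by rewrite pnatr_eq0 -lt0n; apply: leq_trans hp.
by field; rewrite X0 p0 gt_eqF.
Qed.

Lemma mple_abs n (x : config n) (m := xbar x : R) : 0 <= m ^+ p -> 0 < `|m| < 1 ->
  mple p x = (g `|m|)%:E.
Proof.
move=> mp /andP[m0 m1]; have mn0 : m != 0 by rewrite -normr_gt0.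
rewrite /mple -/m (negbTE mn0) mple_coefE // eartanhE; last by rewrite -ltr_norml.
rewrite -EFinM mplfunE // -normrX (ger0_norm mp); congr _%:E.
suff -> : artanh `|m| * `|m| = artanh m * m by ring.
by case: (ler0P m) => // _; rewrite artanhN mulrNN.
Qed.

(** Here the mean is negative and [p] odd: the coefficient is positive and [eartanh] is negative,
    being [-oo] at the mean -1. *)
Lemma mple_neg n (x : config n) : (0 < n)%N -> (xbar x : R) ^+ p < 0 ->
  (mple p x <= 0 :> \bar R)%E.
Proof.
move=> n0; have := @xbar_itv R n x n0; set m := xbar x => m1 mp.
have mneg : m < 0.
  by rewrite ltNge; apply/negP => m0; move: mp; rewrite ltNge exprn_ge0.
rewrite /mple -/m (lt_eqF mneg) mple_coefE ?lt_eqF //.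
apply: mule_ge0_le0.
  rewrite lee_fin mulr_le0 ?ltW // invr_lt0 pmulr_rlt0 // ltr0n.
  exact: leq_trans hp.
have [->|mN1] := eqVneq m (-1).
  rewrite /eartanh eqxx ifF ?leNye //; apply/eqP; lra.
have m1' : -1 < m < 1 by rewrite lt_neqAle eq_sym mN1; lra.
rewrite eartanhE // lee_fin -oppr_ge0 -artanhN ltW // artanh_gt0 //; lra.
Qed.

Lemma artanh_ge_half x : 0 <= x < 1 -> x / 2 <= artanh x.
Proof.
move=> x1; rewrite /artanh; have := @ln_ge0 R (1 + x); have := @le_ln1Dx R (- x).
by move=> h1 h2; have := h1 _; have := h2 _; lra.
Qed.

(** Since [p - 1 >= 2], [g x >= (x / 2) / (p x^2) = 1 / (2 p x)], which blows up at 0; [K] makes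
    this exceed [|b|] for [x <= 1 / K]. *)
Lemma mplfun_near0 s b : mplfun_valley p s ->
  exists2 d, 0 < d <= s & forall x, 0 < x <= d -> b < g x.
Proof.
move=> [s0 s1 g_dec _].
have p0 : 0 < p%:R :> R by rewrite ltr0n; apply: leq_trans hp.
pose K := 2 * p%:R * (`|b| + 1); have b0 := normr_ge0 b.
have K0 : 0 < K by rewrite /K !mulr_gt0 //; lra.
have iK0 : 0 < K^-1 by rewrite invr_gt0.
pose d := Num.min s K^-1.
have d0 : 0 < d by rewrite lt_min s0.
have ds : d <= s by rewrite ge_min lexx.
have dK : d <= K^-1 by rewrite ge_min lexx orbT.
exists d; first by rewrite d0.
have gd : b < g d.
  apply: le_lt_trans (ler_norm b) _; rewrite /mplfun ltr_pdivlMr ?mulr_gt0 ?exprn_gt0 //.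
  apply: lt_le_trans (artanh_ge_half (_ : 0 <= d < 1)); last by lra.
  have dp : d ^+ p.-1 <= d ^+ 2.
    apply: ler_wiXn2l; [lra|lra|by case: p hp => [|[|[]]]].
  have : `|b| * (p%:R * d ^+ p.-1) <= `|b| * (p%:R * d ^+ 2).
    by rewrite !ler_wpM2l // ltW.
  move/le_lt_trans; apply.
  have : K * d <= 1 by rewrite -ler_pdivlMl // mulr1.
  rewrite /K => Kd.
  have : p%:R * (`|b| + 1) * d <= 2^-1 by lra.
  move=> /(ler_wpM2r (ltW d0)).
  have : 0 < p%:R * d * d by rewrite !mulr_gt0.
  rewrite expr2; lra.
move=> x /andP[x0]; rewrite le_eqVlt => /orP[/eqP-> //|xd].
by apply: lt_trans gd _; apply: g_dec.
Qed.

End Mple.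

(** * The slopes of the two estimators *)

Section Slopes.
Context {R : realType} (p : nat) (hp : (3 <= p)%N).
Implicit Types (b e r s x y z d : R).
Local Notation g := (@mplfun R p).

(** The spontaneous magnetization at [b]: the positive maximizer of [cw_H p b], around which the
    absolute value of the mean concentrates. *)
Definition is_magnetization s b r :=
  [/\ 0 <= b, s < r < 1, g r = b & 0 < cw_H p b r].

Lemma magnetization_lt s b0 b r0 r : mplfun_valley p s -> b0 < b ->
  is_magnetization s b0 r0 -> is_magnetization s b r -> r0 < r.
Proof.
move=> [s0 s1 _ g_inc] b01 [_ sr0 gr0 _] [_ sr gr _].
rewrite ltNge; apply/negP => rr; move: b01; apply/negP; rewrite -leNgt -gr -gr0.
by move: rr; rewrite le_eqVlt => /orP[/eqP->//|rr]; apply/ltW/g_inc; lra.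
Qed.

(** The observed mean will lie within [d] of [r] in absolute value; the room from [r + d] to
    [r + 2 d] is for a sample that beats it. *)
Lemma cw_H_window r0 r e b : r0 < r -> r < 1 -> 0 < e ->
  exists2 d, [/\ 0 < d, r0 <= r - d & r + 2 * d < 1] &
    forall y, r - d <= y <= r + 2 * d -> `|cw_H p b y - cw_H p b r| <= e.
Proof.
move=> r01 r1 e0; have [d d0 Hd] := cw_H_near p b r e0.
pose d' := Num.min (d / 2) (Num.min (r - r0) ((1 - r) / 3)).
have [A B C D] : [/\ 0 < d', d' <= d / 2, d' <= r - r0 & d' <= (1 - r) / 3].
  by rewrite !lt_min !ge_min !lexx ?orbT; split => //; lra.
clearbody d'; exists d'; first by split; lra.
by move=> y yr; apply: Hd; rewrite ler_norml; lra.
Qed.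

Lemma pow_abs_lt (x y : R) : 0 <= x ^+ p -> x ^+ p < y ^+ p -> `|x| < `|y|.
Proof.
move=> xp xy; rewrite ltNge; apply/negP => yx; move: xy; apply/negP; rewrite -leNgt.
apply: le_trans (ler_norm _) _; rewrite -(ger0_norm xp) !normrX.
by apply: lerXn2r; rewrite ?nnegrE.
Qed.

Lemma pow_lt_abs (x y : R) : 0 <= x ^+ p -> `|x| < y -> x ^+ p < y ^+ p.
Proof.
move=> xp xy; rewrite -(ger0_norm xp) normrX ltrXn2r ?nnegrE ?normr_ge0 //.
by rewrite -lt0n; apply: leq_trans hp.
Qed.

Lemma mple_pos n (x : config n) : 0 < (xbar x : R) < 1 -> mple p x = (g (xbar x))%:E.
Proof.
move=> /andP[x0 x1]; have := @mple_abs R p hp n x.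
by rewrite /= (gtr0_norm x0) x0 x1 exprn_ge0 ?(ltW x0) // => ->.
Qed.

Lemma mple_itv s n (x : config n) (a c : R) : mplfun_valley p s ->
  0 <= (xbar x : R) ^+ p -> s <= a -> c < 1 -> a < `|xbar x : R| < c ->
  ((g a)%:E < mple p x < (g c)%:E)%E.
Proof.
move=> [s0 s1 _ g_inc] xp sa c1 /andP[ax xc].
have x0 := le_lt_trans sa ax; have x1 := lt_trans xc c1.
rewrite mple_abs ?(lt_trans s0 x0) // !lte_fin !g_inc //.
exact: ltW.
Qed.

Lemma cw_H_le_of_gt s b0 r0 a x : mplfun_valley p s -> s <= r0 -> g r0 = b0 ->
  r0 <= a -> -1 <= x <= 1 -> 0 <= x ^+ p -> a < `|x| -> cw_H p b0 x <= cw_H p b0 a.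
Proof.
move=> vs sr0 gr0 ra x1 xp ax; rewrite cw_H_abs //; apply/ltW/(cw_H_dec hp vs sr0) => //.
  by rewrite gr0.
by rewrite ler_norml.
Qed.

(* The maximum with 0 comes from the sample means below the minimizer of
   [mplfun], where the pseudolikelihood estimate is large although [cw_H] is
   close to 0: there it departs from the maximum likelihood estimate. *)
Lemma cw_H_le_of_mple_gt s b0 r0 a n (y : config n) : mplfun_valley p s ->
  s <= r0 -> g r0 = b0 -> r0 <= a -> a < 1 -> (0 < n)%N ->
  ((g a)%:E < mple p y)%E ->
  cw_H p b0 (xbar y) <= Num.max 0 (cw_H p b0 a).
Proof.
move=> vs sr0 gr0 ra a1 n0 ay; have [s0 s1 g_dec g_inc] := vs.
have sa := le_trans sr0 ra; have a0 := lt_le_trans s0 sa.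
have ga : 0 < g a by apply: (mplfun_gt0 hp); rewrite a0.
have b0a : b0 <= g a.
  move: ra; rewrite le_eqVlt => /orP[/eqP<-|ra]; first by rewrite gr0.
  by rewrite -gr0; exact/ltW/g_inc.
have [yp|yp] := ltP ((xbar y : R) ^+ p) 0.
  by have := lt_le_trans ay (mple_neg hp n0 yp); rewrite lte_fin ltNge (ltW ga).
have y1 := @xbar_itv R n y n0.
have y0 : 0 < `|xbar y : R|.
  rewrite normr_gt0; apply: contraTneq ay => y0.
  by rewrite /mple y0 eqxx -leNgt lee_fin ltW.
have [ay'|ya] := ltP a `|xbar y : R|.
  by rewrite le_max (cw_H_le_of_gt vs sr0 gr0 ra) // orbT.
have gy : g a < g `|xbar y|.
  by rewrite -lte_fin -mple_abs // y0 (le_lt_trans ya).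
rewrite le_max cw_H_abs // (cw_H_le0 hp vs) //; last first.
  by move=> _; apply: le_trans b0a (ltW gy).
(* A mean of absolute value at most [a] and right of [s] has [g] at most [g a]; so this one lies on
   the decreasing branch. *)
rewrite (ltW y0) leNgt; apply/negP => sy; move: gy; apply/negP; rewrite -leNgt.
move: ya; rewrite le_eqVlt => /orP[/eqP-> //|ya].
by apply/ltW/g_inc => //; exact: ltW.
Qed.

Lemma near_mean_itv r d n (x : config n) : @near_mean R p r d n x ->
  0 <= (xbar x : R) ^+ p /\ r - d < `|xbar x : R| < r + d.
Proof. by move=> /andP[? ?]; rewrite -ltr_distlC distrC. Qed.

(** Samples beating one of mean near [r] have a mean beyond [r - d] in absolute value, where
    [cw_H p b0] decreases. Those with mean in []r + d, r + 2 d[] nearly attain the bound. *)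
Lemma mle_bahadur_slope s b0 b r0 r : mplfun_valley p s -> b0 < b ->
  is_magnetization s b0 r0 -> is_magnetization s b r ->
  is_bahadur_slope p (mle p) b0 b (2 * (cw_H p b0 r0 - cw_H p b0 r)).
Proof.
move=> vs b01 m0 m1; have rr := magnetization_lt vs b01 m0 m1.
have [s0 s1 _ _] := vs.
case: m0 m1 => [b00 sr0 gr0 Hr0] [bb0 sr gr Hr].
have [sr0' r01] : s <= r0 /\ 0 <= r0 < 1 by split; lra.
have [rp r1] : 0 < r /\ r < 1 by split; lra.
apply: bahadur_slope_criterion.
- by move=> n x y xy; apply: mle_eq; rewrite xy.
- by move=> n y n0; apply: (cw_H_le_argmax hp vs) => //; exact: xbar_itv.
- by move=> e e0; apply: cw_H_dense.
move=> e e0; have [d [d0 rd rd1] Hd] := cw_H_window b0 rr r1 e0.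
exists (@near_mean R p r d); split; first exact: (concentration hp vs).
have [rd0 rdd rd1'] : [/\ -1 <= r + d, r + d < r + 2 * d & r + 2 * d <= 1].
  by clear -rp d0 rd1; split; lra.
have Hl : cw_H p b0 (r - d) <= cw_H p b0 r + e.
  have := Hd (r - d); clear -d0; rewrite ler_norml => /(_ _)/andP[|_]; lra.
near=> n => x /near_mean_itv[xp /andP[xl xr]].
have n0 : (0 < n)%N by near: n; exact: nbhs_infty_gt.
split=> [y|].
  rewrite mle_ltE // => xy; have yp := le_trans xp (ltW xy).
  apply: le_trans Hl; apply: (cw_H_le_of_gt vs sr0' gr0) => //; first exact: xbar_itv.
  exact: lt_trans xl (pow_abs_lt xp xy).
have [y /andP[yl yr]] : exists y : config n, r + d < (xbar y : R) < r + 2 * d.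
  by near: n; exact: xbar_dense.
exists y; first by rewrite mle_ltE // pow_lt_abs // (lt_trans xr).
have := Hd (xbar y); clear -yl yr d0; rewrite ler_norml => /(_ _)/andP[|+ _]; lra.
Unshelve. all: by end_near. Qed.

Lemma mple_bahadur_slope s b0 b r0 r : mplfun_valley p s -> b0 < b ->
  is_magnetization s b0 r0 -> is_magnetization s b r ->
  is_bahadur_slope p (mple p) b0 b
    (2 * (cw_H p b0 r0 - Num.max 0 (cw_H p b0 r))).
Proof.
move=> vs b01 m0 m1; have rr := magnetization_lt vs b01 m0 m1.
have [s0 s1 _ g_inc] := vs.
case: m0 m1 => [b00 sr0 gr0 Hr0] [bb0 sr gr Hr].
have [sr0' r01] : s <= r0 /\ 0 <= r0 < 1 by split; lra.
have [rp r1] : 0 < r /\ r < 1 by split; lra.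
apply: bahadur_slope_criterion.
- by move=> n x y xy; apply: mple_eq; rewrite xy.
- by move=> n y n0; apply: (cw_H_le_argmax hp vs) => //; exact: xbar_itv.
- by move=> e e0; apply: cw_H_dense.
move=> e e0; have [d [d0 rd rd1] Hd] := cw_H_window b0 rr r1 e0.
exists (@near_mean R p r d); split; first exact: (concentration hp vs).
have [c c0 Hc] := cw_H_near p b0 0 e0.
(* Means in []0, a[] have estimates above every one observed in the window, and [cw_H p b0] within
   [e] of 0. They are the witnesses when [cw_H p b0 r < 0]. *)
have [q /andP[q0 qs] Hq] := mplfun_near0 hp (g (r + d)) vs.
pose a := Num.min c q; have [a0 ac aq] : [/\ 0 < a, a <= c & a <= q].
  by rewrite lt_min !ge_min !lexx ?orbT c0 q0.
clearbody a.
have [rd0 rdd rd1'] : [/\ -1 <= r + d, r + d < r + 2 * d & r + 2 * d <= 1].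
  by clear -rp d0 rd1; split; lra.
have [srl rd1l rdu] : [/\ s <= r - d, r - d < 1 & r + d < 1].
  by clear -rp d0 rd1 rd sr0'; split; lra.
have [srd rdp] : s <= r + d /\ 0 < r + d by clear -srl d0 rp; split; lra.
have a1 : a <= 1 by clear -aq qs s1; lra.
have Hl : Num.max 0 (cw_H p b0 (r - d)) <= Num.max 0 (cw_H p b0 r) + e.
  have : cw_H p b0 (r - d) <= cw_H p b0 r + e.
    have := Hd (r - d); clear -d0; rewrite ler_norml => /(_ _)/andP[|_]; lra.
  have : 0 <= Num.max 0 (cw_H p b0 r) by rewrite le_max lexx.
  have : cw_H p b0 r <= Num.max 0 (cw_H p b0 r) by rewrite le_max lexx orbT.
  by clear -e0 => *; rewrite ge_max; apply/andP; split; lra.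
near=> n => x /near_mean_itv[xp xlr].
have n0 : (0 < n)%N by near: n; exact: nbhs_infty_gt.
have /andP[Tl Tr] := mple_itv vs xp srl rdu xlr.
split=> [y Txy|].
  apply: le_trans Hl; apply: (cw_H_le_of_mple_gt vs sr0' gr0) => //.
  exact: lt_trans Tl Txy.
have [H0|H0] := leP 0 (cw_H p b0 r).
  have [y /andP[yl yr]] : exists y : config n, r + d < (xbar y : R) < r + 2 * d.
    by near: n; exact: xbar_dense.
  exists y.
    rewrite (@mple_pos n y) ?(lt_trans rdp yl) ?(lt_le_trans yr) //.
    by apply: lt_trans Tr _; rewrite lte_fin g_inc // (lt_le_trans yr).
  have := Hd (xbar y); clear -yl yr d0; rewrite ler_norml => /(_ _)/andP[|+ _]; lra.
have [y /andP[yl yr]] : exists y : config n, 0 < (xbar y : R) < a.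
  by near: n; apply: xbar_dense => //; rewrite lerN10.
exists y.
  rewrite (@mple_pos n y) ?yl ?(lt_le_trans yr) //.
  by apply: lt_trans Tr _; rewrite lte_fin Hq // yl (le_trans (ltW yr)).
have := Hc (xbar y); rewrite cw_H0 // !subr0 gtr0_norm // (le_trans (ltW yr)) //.
by rewrite ler_norml sub0r => /(_ isT)/andP[].
Unshelve. all: by end_near. Qed.

Lemma bahadur_slopeE (T : estimator R) b0 b (c : R) : is_bahadur_slope p T b0 b c ->
  has_bahadur_slope p T b0 b /\ bahadur_slope p T b0 b = c.
Proof.
move=> Hc; split; first by exists c.
apply: (is_bahadur_slope_inj _ Hc); apply: (@xgetPex _ 0 [set c | is_bahadur_slope p T b0 b c]).
by exists c.
Qed.

(** * The threshold and the comparison of the slopes *)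

Lemma cw_H1 b : cw_H p b 1 = b - ln 2.
Proof.
rewrite cw_HE expr1n mulr1 /cw_H mul0r subrr mul0r addr0 sub0r.
by rewrite mulrA mulVf // mul1r.
Qed.

(** If [cw_H p b0] were nowhere positive, its supremum would be its value 0 at 0 and [b0] would
    belong to [S]. The set [S] contains 0 and is bounded by [ln 2], the value at 1 being
    [b - ln 2]. *)
Lemma beta_star_lt b0 : beta_star p < b0 ->
  0 <= b0 /\ exists2 z, 0 <= z <= 1 & 0 < cw_H p b0 z.
Proof.
rewrite /beta_star; set S := [set _ | _] => Sb0.
have H_ub (c x : R) : 0 <= c -> -1 <= x <= 1 -> cw_H p c x <= c.
  move=> c0 x1; rewrite cw_HE; have := cw_H_b0_le0 hp x1.
  have : x ^+ p <= 1.
    apply: le_trans (ler_norm _) _; rewrite normrX exprn_ile1 // ler_norml //.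
  by move=> /(ler_wpM2l c0); lra.
have S0 : S 0.
  split => //; apply/eqP; rewrite eq_le; apply/andP; split.
    apply: ge_sup; first by exists (cw_H p 0 0), 0 => //=; rewrite in_itv /=; lra.
    by move=> _ [x /= ] + <-; rewrite in_itv /=; exact: H_ub.
  apply: ub_le_sup; first by exists 0 => _ [x /=] + <-; rewrite in_itv /=; exact: H_ub.
  by exists 0; [rewrite /= in_itv /=; lra|rewrite cw_H0].
have Sub : has_ubound S.
  exists (ln 2) => c [c0 cS]; rewrite -subr_le0 -cw_H1 -cS; apply: ub_le_sup.
    by exists c => _ [x /=] + <-; rewrite in_itv /=; exact: H_ub.
  by exists 1; rewrite //= in_itv /=; lra.
have b00 : 0 <= b0 by apply: le_trans (ub_le_sup Sub S0) (ltW Sb0).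
split => //; apply: contrapT => no.
have b0S : S b0.
  split => //; apply/eqP; rewrite eq_le; apply/andP; split.
    apply: ge_sup; first by exists (cw_H p b0 0), 0 => //=; rewrite in_itv /=; lra.
    move=> _ [x /= ] + <-; rewrite in_itv /= => x1; rewrite leNgt; apply/negP => xH.
    have [xp|xp] := ltP (x ^+ p) 0.
      by have := cw_H_neg hp b00 x1 xp; rewrite leNgt xH.
    apply: no; exists `|x|; last by rewrite -cw_H_abs.
    by rewrite normr_ge0 ler_norml.
  apply: ub_le_sup; first by exists b0 => _ [x /=] + <-; rewrite in_itv /=; exact: H_ub.
  by exists 0; [rewrite /= in_itv /=; lra|rewrite cw_H0].
by have := ub_le_sup Sub b0S; rewrite leNgt Sb0.
Qed.

(** Close to 1, [cw_H] decreases strictly to its value [b0 - ln 2 >= 0] at 1. *)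
Lemma ln2_le_pos s b0 : mplfun_valley p s -> ln 2 <= b0 ->
  exists2 z, 0 <= z <= 1 & 0 < cw_H p b0 z.
Proof.
move=> vs b0l; have [s0 s1 _ _] := vs.
have [x sx bx] : exists2 x, s < x < 1 & b0 < g x by apply: (mplfun_unbounded hp); lra.
exists x; first lra.
apply: (@le_lt_trans _ _ (cw_H p b0 1)); first by rewrite cw_H1 subr_ge0.
by apply: (cw_H_dec hp vs (r := x)) => //; lra.
Qed.

(** Raising the parameter can only increase [cw_H] on [[0, 1]], so positivity at [z] persists from
    [b0] to [b]. *)
Lemma magnetization_exists s b0 b z : mplfun_valley p s -> 0 <= b0 -> b0 <= b ->
  0 <= z <= 1 -> 0 < cw_H p b0 z -> exists r, is_magnetization s b r.
Proof.
move=> vs b00 b01 z1 Hz.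
have [|r [sr gr Hr]] := cw_H_argmax hp vs (b := b) z1.
  apply: lt_le_trans Hz _; rewrite cw_HE (cw_HE _ b) lerD2r ler_wpM2r //.
  by rewrite exprn_ge0 //; case/andP: z1.
by exists r; split => //; apply: le_trans b01.
Qed.

End Slopes.

Theorem theorem3 (R : realType) (p : nat) (hp : (3 <= p)%N) :
  (forall b0 b d : R, ln 2 <= b0 -> b0 < b -> 0 < d < 1 ->
    [/\ has_bahadur_slope p (mle p) b0 b,
        has_bahadur_slope p (mple p) b0 b,
        bahadur_slope p (mple p) b0 b = bahadur_slope p (mle p) b0 b,
        opt_sample_size p (mple p) b0 b d = opt_sample_size p (mle p) b0 b d
      & eff p (mle p) (mple p) b0 b = 1])
  /\
  (forall b0 d : R, beta_star p < b0 -> b0 < ln 2 -> 0 < d < 1 ->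
    exists B : R, forall b : R, b0 < b -> B < b ->
      has_bahadur_slope p (mle p) b0 b /\
      has_bahadur_slope p (mple p) b0 b /\
      bahadur_slope p (mple p) b0 b <> bahadur_slope p (mle p) b0 b /\
      opt_sample_size p (mple p) b0 b d <> opt_sample_size p (mle p) b0 b d /\
      1 < eff p (mle p) (mple p) b0 b).
Proof.
have [s vs] := mplfun_valleyP hp (R := R); have [s0 s1 _ g_inc] := vs.
split.
  move=> b0 b d b0l b01 d01.
  have b00 : 0 <= b0 by apply: le_trans b0l; rewrite ln_ge0 // ler1n.
  have [z z1 Hz] := ln2_le_pos hp vs b0l.
  have [r0 m0] := magnetization_exists hp vs b00 (lexx b0) z1 Hz.
  have [r m1] := magnetization_exists hp vs b00 (ltW b01) z1 Hz.
  have rr := magnetization_lt vs b01 m0 m1.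
  have [hM EM] := bahadur_slopeE (mle_bahadur_slope hp vs b01 m0 m1).
  have [hP EP] := bahadur_slopeE (mple_bahadur_slope hp vs b01 m0 m1).
  have [_ sr0 gr0 _] := m0; have [_ sr _ _] := m1.
  have Hr : 0 <= cw_H p b0 r.
    apply: ltW; apply: (@le_lt_trans _ _ (cw_H p b0 1)); first by rewrite cw_H1 subr_ge0.
    by apply: (cw_H_dec hp vs (r := r0)); rewrite ?gr0 //; lra.
  have Hrr : cw_H p b0 r < cw_H p b0 r0.
    by apply: (cw_H_dec hp vs (r := r0)); rewrite ?gr0 //; lra.
  have EPM : bahadur_slope p (mple p) b0 b = bahadur_slope p (mle p) b0 b.
    by rewrite EP EM (max_idPr Hr).
  split; [exact: hM|exact: hP|exact: EPM|by rewrite /opt_sample_size EPM|].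
  by rewrite /eff EPM divff // EM mulf_neq0 // subr_eq0 gt_eqF.
move=> b0 d bs b0l d01.
have [b00 [z z1 Hz]] := beta_star_lt hp bs.
have [r0 m0] := magnetization_exists hp vs b00 (lexx b0) z1 Hz.
have [_ sr0 gr0 Hr0] := m0.
have e0 : 0 < (ln 2 - b0) / 2 by lra.
have [c c0 Hc] := cw_H_near p b0 1 e0.
(* [x1] is close enough to 1 for [cw_H p b0 x1] to stay negative, like the value [b0 - ln 2] at 1;
   [b > g x1] then forces [r > x1]. *)
pose x1 := Num.max ((r0 + 1) / 2) (1 - c).
have [x1r x11 x1c] : [/\ r0 < x1, x1 < 1 & 1 - c <= x1].
  by rewrite lt_max gt_max le_max lexx orbT; split => //; lra.
clearbody x1; exists (mplfun p x1) => b b01 Bb.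
have [r m1] := magnetization_exists hp vs b00 (ltW b01) z1 Hz.
have [_ sr gr _] := m1.
have xr : x1 < r.
  rewrite ltNge; apply/negP => rx; move: Bb; apply/negP; rewrite -leNgt -gr.
  by move: rx; rewrite le_eqVlt => /orP[/eqP->//|rx]; apply/ltW/g_inc; lra.
have Hx1 : cw_H p b0 x1 < 0.
  have : `|cw_H p b0 x1 - cw_H p b0 1| <= (ln 2 - b0) / 2.
    by apply: Hc; rewrite ler_norml; lra.
  rewrite ler_norml cw_H1; lra.
have Hr : cw_H p b0 r < 0.
  apply: lt_trans Hx1; apply: (cw_H_dec hp vs (r := r0)); rewrite ?gr0 //; lra.
have [hM EM] := bahadur_slopeE (mle_bahadur_slope hp vs b01 m0 m1).
have [hP EP] := bahadur_slopeE (mple_bahadur_slope hp vs b01 m0 m1).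
move: EP; rewrite (max_idPl (ltW Hr)) subr0 => EP.
move: (cw_H p b0 r0) (cw_H p b0 r) Hr0 Hr EM EP => F h F0 h0 EM EP.
have lt_PM : bahadur_slope p (mple p) b0 b < bahadur_slope p (mle p) b0 b.
  rewrite EM EP; lra.
have P0 : 0 < bahadur_slope p (mple p) b0 b by rewrite EP; lra.
split; first exact: hM.
split; first exact: hP.
split; first exact/eqP/negbT/lt_eqF.
split; last by rewrite /eff ltr_pdivlMr // mul1r.
rewrite /opt_sample_size => /mulfI H.
have /H /invr_inj /eqP : - 2 * ln d != 0.
  by rewrite mulf_neq0 ?oppr_eq0 ?pnatr_eq0 // lt_eqF // ln_lt0.
by rewrite lt_eqF.
Qed.
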